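(* Let $(R,\mathfrak{m})$ be a commutative Noetherian local ring which is a quotient of a Cohen-Macaulay ring, $\mathcal{S}$ a Serre class of $R$-modules, and $M$ a finitely generated $R$-module. Let $\mathfrak{a}_M$ be an ideal of $R$ such that the non-Cohen-Macaulay locus of $M$ equals $V(\mathfrak{a}_M)$. Then the following are equivalent: (i) $M$ is an $\mathcal{S}$-Cohen-Macaulay $R$-module. (ii) $R/\mathfrak{a}_M\in\mathcal{S}$ and $\dim(R/\mathfrak{p})=\dim M$ for all prime ideals $\mathfrak{p}\in\min(\mathcal{S}\text{-}\mathrm{Supp}_R(M))$.
   Context: A Serre class $\mathcal{S}$ of $R$-modules is a (nonempty) class of $R$-modules such that for every exact sequence $0\to L\to M\to N\to 0$ of $R$-modules, $M\in\mathcal{S}$ if and only if $L\in\mathcal{S}$ and $N\in\mathcal{S}$. A sequence $x_1,\dots,x_r$ in $R$ is a weak $M$-sequence with respect to $\mathcal{S}$ if for each $i=1,\dots,r$ the module $((x_1,\dots,x_{i-1})M:_M x_i)/(x_1,\dots,x_{i-1})M$ belongs to $\mathcal{S}$, where $(N:_M x)=\{m\in M: xm\in N\}$. A finitely generated module $M$ over a local ring is $\mathcal{S}$-Cohen-Macaulay if every system of parameters of $M$ is a weak $M$-sequence with respect to $\mathcal{S}$. $\mathcal{S}\text{-}\mathrm{Supp}_R(M)=\{\mathfrak{p}\in\mathrm{Supp}_R M: R/\mathfrak{p}\notin\mathcal{S}\}$, and $\min(X)$ denotes the set of members of a set $X$ of primes that are minimal under inclusion. The non-Cohen-Macaulay locus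 of $M$ is $\{\mathfrak{p}\in\mathrm{Spec}\,R: M_{\mathfrak{p}}\text{ is not Cohen-Macaulay}\}$ (the zero module is regarded as Cohen-Macaulay). When $R$ is a quotient of a Cohen-Macaulay ring, this locus is Zariski closed in $\mathrm{Spec}\,R$, so an ideal $\mathfrak{a}_M$ as in the claim exists, and it is unique up to radical. *)

(* Defs.v *)
From HB Require Import structures.
From mathcomp Require Import all_boot all_order all_algebra.
From mathcomp Require Import ring.
From mathcomp Require Import boolp classical_sets constructive_ereal.

Set Implicit Arguments.
Unset Strict Implicit.
Unset Printing Implicit Defensive.

Import GRing.Theory.
Local Open Scope quotient_scope.
Local Open Scope ring_scope.

(* Supremum of a set of natural numbers: [-oo] for the empty set and [+oo] for
   an unbounded one. *)
Definition nat_sup (P : nat -> Prop) : \bar nat :=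
  if `[< exists n, P n >] then
    xget +oo%E [set e | exists2 n, P n /\ (forall k, P k -> (k <= n)%N)
                                 & e = n%:E%E]
  else -oo%E.

(* A chain t_0 < ... < t_n has length n. *)
Definition chain_sup (T : Type) (lt : T -> T -> Prop) (X : T -> Prop) :
    \bar nat :=
  nat_sup (fun n => exists t : nat -> T,
    (forall i, (i <= n)%N -> X (t i)) /\
    (forall i, (i < n)%N -> lt (t i) (t i.+1))).

Section Quotients.
Variables (R : comNzRingType) (M : lmodType R) (U : submodClosed M).

(* [U] as a [zmodClosed], as required by [Quotient.quot]. *)
Definition submod_pred : pred M := fun x => x \in U.

Lemma submod_pred_closed : submod_closed submod_pred.
Proof.
by split=> [|a x y Ux Uy]; [exact: (rpred0 U) | exact/rpredD/Uy/rpredZ].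
Qed.
HB.instance Definition _ :=
  GRing.isSubmodClosed.Build R M submod_pred submod_pred_closed.

Definition zmod_of_submod : zmodClosed M :=
  GRing.ZmodClosed.clone M submod_pred _.

Definition quotmod := @Quotient.quot M zmod_of_submod.
HB.instance Definition _ := GRing.Zmodule.on quotmod.

Definition quot_proj (x : M) : quotmod := \pi_(Quotient.quot zmod_of_submod) x.

Lemma quot_projW (P : quotmod -> Prop) : (forall x, P (quot_proj x)) -> forall z, P z.
Proof. by move=> h z; rewrite -(reprK z). Qed.

Lemma quot_projD x y : quot_proj x + quot_proj y = quot_proj (x + y).
Proof. by rewrite /quot_proj raddfD. Qed.

Definition quotmod_scale (a : R) (z : quotmod) : quotmod := quot_proj (a *: repr z).

Lemma quotmod_scaleE a x : quotmod_scale a (quot_proj x) = quot_proj (a *: x).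
Proof.
apply/eqP; rewrite /quotmod_scale -Quotient.idealrBE -scalerBr.
have Ux : repr (quot_proj x) - x \in zmod_of_submod.
  by rewrite Quotient.idealrBE reprK.
exact: (@rpredZ R M U a _ Ux).
Qed.

Lemma quotmod_scaleA a b z :
  quotmod_scale a (quotmod_scale b z) = quotmod_scale (a * b) z.
Proof. by elim/quot_projW: z => x; rewrite !quotmod_scaleE scalerA. Qed.

Lemma quotmod_scale1 : left_id 1 quotmod_scale.
Proof. by elim/quot_projW=> x; rewrite quotmod_scaleE scale1r. Qed.

Lemma quotmod_scaleDr : right_distributive quotmod_scale +%R.
Proof.
move=> a; elim/quot_projW=> x; elim/quot_projW=> y.
by rewrite quot_projD !quotmod_scaleE scalerDr quot_projD.
Qed.

Lemma quotmod_scaleDl z : {morph quotmod_scale^~ z : a b / a + b}.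
Proof.
by elim/quot_projW: z => x a b; rewrite !quotmod_scaleE scalerDl quot_projD.
Qed.

HB.instance Definition _ := GRing.Zmodule_isLmodule.Build R quotmod
  quotmod_scaleA quotmod_scale1 quotmod_scaleDr quotmod_scaleDl.
End Quotients.

Section Submodules.
Variables (R : comNzRingType) (M : lmodType R).

Definition submod (V : submodClosed M) := {x : M | x \in V}.
Section Submod.
Variable V : submodClosed M.
HB.instance Definition _ := SubChoice.on (submod V).
HB.instance Definition _ := [SubChoice_isSubLmodule of submod V by <:].

Variable U : submodClosed M.
Definition restr_pred : pred (submod V) := fun x => val x \in U.
Lemma restr_pred_closed : submod_closed restr_pred.
Proof.
split=> [|a x y Ux Uy]; first exact: (rpred0 U).
by rewrite unfold_in /restr_pred linearP /= rpredD ?rpredZ.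
Qed.
HB.instance Definition _ :=
  GRing.isSubmodClosed.Build R (submod V) restr_pred restr_pred_closed.
Definition submod_restr : submodClosed (submod V) :=
  GRing.SubmodClosed.clone R (submod V) restr_pred _.

(* V / U; it is used with [U] contained in [V]. *)
Definition subquot : lmodType R := quotmod submod_restr.
End Submod.

(* (x_1, ..., x_n) M *)
Definition seq_mul_pred (xs : seq R) : pred M :=
  fun x => `[< exists y : 'I_(size xs) -> M, x = \sum_(j < size xs) xs`_j *: y j >].
Lemma seq_mul_closed xs : submod_closed (seq_mul_pred xs).
Proof.
split=> [|a x y /asboolP[u ->] /asboolP[v ->]]; apply/asboolP.
  by exists (fun=> 0); rewrite big1 // => i _; rewrite scaler0.
exists (fun j => a *: u j + v j); rewrite scaler_sumr -big_split /=.
by apply: eq_bigr => j _; rewrite scalerDr !scalerA mulrC.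
Qed.
HB.instance Definition _ xs :=
  GRing.isSubmodClosed.Build R M (seq_mul_pred xs) (seq_mul_closed xs).
Definition seq_mul (xs : seq R) : submodClosed M :=
  GRing.SubmodClosed.clone R M (seq_mul_pred xs) _.

(* (N :_M x) *)
Definition colon_pred (N : submodClosed M) (x : R) : pred M := fun y => x *: y \in N.
Lemma colon_closed N x : submod_closed (colon_pred N x).
Proof.
split=> [|a y z Ny Nz].
  by change (x *: 0 \in N); rewrite scaler0 rpred0.
change (x *: (a *: y + z) \in N).
rewrite scalerDr scalerA mulrC -scalerA.
by apply: rpredD; [apply: rpredZ; exact: Ny | exact: Nz].
Qed.
HB.instance Definition _ N x :=
  GRing.isSubmodClosed.Build R M (colon_pred N x) (colon_closed N x).
Definition colon (N : submodClosed M) (x : R) : submodClosed M :=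
  GRing.SubmodClosed.clone R M (colon_pred N x) _.

Definition fin_gen : Prop :=
  exists g : seq M, forall x, exists c : 'I_(size g) -> R, x = \sum_(j < size g) c j *: g`_j.

Definition submod_lt (U V : submodClosed M) : Prop :=
  {subset U <= V} /\ ~ {subset V <= U}.

(* The length of M: [+oo] if M does not have finite length. *)
Definition mod_length : \bar nat :=
  chain_sup submod_lt (fun=> True).

End Submodules.

Arguments seq_mul {R} M xs.
Arguments fin_gen {R} M.
Arguments mod_length {R} M.

Section Localization.
Variables (R : comNzRingType) (p : prime_idealr R).

Definition denom := {s : R | s \notin p}.

Definition den (s : denom) : R := val s.

Lemma denP s : den s \notin p. Proof. exact: valP s. Qed.

Lemma denom1_subproof : 1 \notin p. Proof. by rewrite idealr1. Qed.
Definition denom1 : denom := exist (fun s => is_true (s \notin p)) 1 denom1_subproof.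

Lemma denomM_subproof s t : den s * den t \notin p.
Proof. by rewrite prime_idealrM negb_or !denP. Qed.
Definition denomM (s t : denom) : denom :=
  exist (fun r => is_true (r \notin p)) _ (denomM_subproof s t).

Lemma den1 : den denom1 = 1. Proof. by []. Qed.
Lemma denM s t : den (denomM s t) = den s * den t. Proof. by []. Qed.
Arguments den : simpl never.

Section LocMod.
Variable M : lmodType R.

Definition frac_equiv (x y : M * denom) : bool :=
  `[< exists u : denom,
        den u *: (den y.2 *: x.1) = den u *: (den x.2 *: y.1) >].

Lemma frac_equiv_is_equiv : equiv_class_of frac_equiv.
Proof.
split=> [x|x y|y x z].
- by apply/asboolP; exists denom1; rewrite /= ?denM ?den1.
- by apply/asboolP/asboolP => -[u e]; exists u.
- move=> /asboolP[u e] /asboolP[v e']; apply/asboolP.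
  exists (denomM (denomM u v) y.2); rewrite /= !denM !scalerA in e e' *.
  transitivity ((den v * den z.2) *: ((den u * den y.2) *: x.1)).
    by rewrite scalerA; congr (_ *: _); ring.
  transitivity ((den u * den x.2) *: ((den v * den y.2) *: z.1)).
    by rewrite e -e' !scalerA; congr (_ *: _); ring.
  by rewrite scalerA; congr (_ *: _); ring.
Qed.

Canonical frac_equiv_equiv := EquivRelPack frac_equiv_is_equiv.
Canonical frac_equiv_encModRel := defaultEncModRel frac_equiv.

(* The localization M_p. *)
Definition locmod := {eq_quot frac_equiv}.
HB.instance Definition _ := Choice.on locmod.
HB.instance Definition _ := EqQuotient.on locmod.

(* m / s *)
Definition frac (m : M) (s : denom) : locmod := \pi_locmod (m, s).

Lemma fracW (P : locmod -> Prop) : (forall m s, P (frac m s)) -> forall z, P z.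
Proof. by move=> h z; rewrite -[z]reprK; case: (repr z) => m s; exact: h. Qed.

Lemma fracP m s n t : frac m s = frac n t <->
  exists u : denom, den u *: (den t *: m) = den u *: (den s *: n).
Proof.
rewrite /frac; split=> [/eqP|h].
  by rewrite piE => /asboolP.
by apply/eqP; rewrite piE; apply/asboolP.
Qed.

Lemma frac_repr z : frac (repr z).1 (repr z).2 = z.
Proof. by rewrite /frac -surjective_pairing reprK. Qed.

Definition frac_add (z w : locmod) : locmod :=
  frac (den (repr w).2 *: (repr z).1 + den (repr z).2 *: (repr w).1)
       (denomM (repr z).2 (repr w).2).
Definition frac_opp (z : locmod) : locmod := frac (- (repr z).1) (repr z).2.
Definition frac_zero : locmod := frac 0 denom1.

Lemma frac_addE m s n t :
  frac_add (frac m s) (frac n t) = frac (den t *: m + den s *: n) (denomM s t).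
Proof.
rewrite /frac_add.
have := frac_repr (frac n t); have := frac_repr (frac m s).
case: (repr (frac m s)) => m' s'; case: (repr (frac n t)) => n' t' /=.
move=> /fracP[u e] /fracP[v e']; apply/fracP; exists (denomM u v); rewrite /= ?denM.
rewrite !scalerDr !scalerA in e e' *; congr (_ + _).
  transitivity ((den v * den t * den t') *: ((den u * den s) *: m')).
    by rewrite scalerA; congr (_ *: _); ring.
  by rewrite e scalerA; congr (_ *: _); ring.
transitivity ((den u * den s * den s') *: ((den v * den t) *: n')).
  by rewrite scalerA; congr (_ *: _); ring.
by rewrite e' scalerA; congr (_ *: _); ring.
Qed.

Lemma frac_oppE m s : frac_opp (frac m s) = frac (- m) s.
Proof.
rewrite /frac_opp; have := frac_repr (frac m s).
case: (repr (frac m s)) => m' s' /= /fracP[u e]; apply/fracP; exists u.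
by rewrite !scalerN e.
Qed.

Lemma frac_addA : associative frac_add.
Proof.
elim/fracW=> m s; elim/fracW=> n t; elim/fracW=> k r.
rewrite !frac_addE; apply/fracP; exists denom1; rewrite /= ?denM ?den1.
rewrite /= !scale1r !scalerDr !scalerA addrA.
by congr (_ *: _ + _ *: _ + _ *: _); ring.
Qed.

Lemma frac_addC : commutative frac_add.
Proof.
elim/fracW=> m s; elim/fracW=> n t.
rewrite !frac_addE; apply/fracP; exists denom1; rewrite /= ?denM ?den1.
rewrite /= !scale1r !scalerDr !scalerA addrC.
by congr (_ *: _ + _ *: _); ring.
Qed.

Lemma frac_add0 : left_id frac_zero frac_add.
Proof.
elim/fracW=> m s; rewrite frac_addE; apply/fracP; exists denom1; rewrite /= ?denM ?den1.
by rewrite /= scaler0 add0r !scale1r mul1r.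
Qed.

Lemma frac_addN : left_inverse frac_zero frac_opp frac_add.
Proof.
elim/fracW=> m s; rewrite frac_oppE frac_addE; apply/fracP; exists denom1; rewrite /= ?denM ?den1.
by rewrite /= scalerN addNr !scaler0.
Qed.

HB.instance Definition _ :=
  GRing.isZmodule.Build locmod frac_addA frac_addC frac_add0 frac_addN.

Lemma fracD m s n t :
  frac m s + frac n t = frac (den t *: m + den s *: n) (denomM s t).
Proof. exact: frac_addE. Qed.

End LocMod.

Section Scale.
Variable M : lmodType R.

(* (a / s) (m / t) = (a m) / (s t), for M arbitrary; the product of R_p is the
   case M = R. *)
Definition frac_scale (c : locmod R^o) (z : locmod M) : locmod M :=
  frac (((repr c).1 : R) *: (repr z).1) (denomM (repr c).2 (repr z).2).

Lemma frac_scaleE (a : R) s (m : M) t :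
  frac_scale (frac (a : R^o) s) (frac m t) = frac (a *: m) (denomM s t).
Proof.
rewrite /frac_scale.
have := frac_repr (frac m t); have := frac_repr (frac (a : R^o) s).
case: (repr (frac _ s)) => a' s'; case: (repr (frac m t)) => m' t' /=.
move=> /fracP[u e] /fracP[v e']; apply/fracP; exists (denomM u v); rewrite /= ?denM.
rewrite !scalerA in e e' *; rewrite /GRing.scale /= in e.
transitivity ((den u * den s * a') *: ((den v * den t) *: m')).
  by rewrite scalerA; congr (_ *: _); ring.
by rewrite e e' scalerA; congr (_ *: _); ring.
Qed.

End Scale.

Definition locring := locmod R^o.
HB.instance Definition _ := GRing.Zmodule.on locring.

Definition loc_mul (x y : locring) : locring := frac_scale x y.
Definition loc_one : locring := frac (1 : R^o) denom1.

Lemma loc_scaleA (M : lmodType R) (a b : locring) (z : locmod M) :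
  frac_scale a (frac_scale b z) = frac_scale (loc_mul a b) z.
Proof.
elim/fracW: a => a s; elim/fracW: b => b t; elim/fracW: z => m r.
rewrite /loc_mul (frac_scaleE b t m r) (frac_scaleE a s (b : R^o) t) !frac_scaleE.
apply/fracP; exists denom1; rewrite /= ?denM ?den1.
by rewrite !scale1r !scalerA; congr (_ *: _); rewrite /GRing.scale /=; ring.
Qed.

Lemma loc_scale1 (M : lmodType R) (z : locmod M) : frac_scale loc_one z = z.
Proof.
elim/fracW: z => m s; rewrite frac_scaleE; apply/fracP; exists denom1; rewrite /= ?denM ?den1.
by rewrite /= mul1r !scale1r.
Qed.

Lemma loc_scaleDr (M : lmodType R) :
  right_distributive (@frac_scale M) +%R.
Proof.
elim/fracW=> a s; elim/fracW=> m t; elim/fracW=> n r.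
rewrite fracD !frac_scaleE fracD; apply/fracP; exists denom1; rewrite /= ?denM ?den1.
rewrite /= !scale1r !scalerDr !scalerA.
by congr (_ *: _ + _ *: _); ring.
Qed.

Lemma loc_scaleDl (M : lmodType R) (z : locmod M) :
  {morph (@frac_scale M)^~ z : a b / a + b}.
Proof.
elim/fracW: z => m t; elim/fracW=> a s; elim/fracW=> b r.
rewrite fracD !frac_scaleE fracD; apply/fracP; exists denom1; rewrite /= ?denM ?den1.
rewrite /= !scale1r !scalerDr !scalerA -scalerDl.
by congr (_ *: _); rewrite /GRing.scale /=; ring.
Qed.

Lemma loc_mulA : associative loc_mul.
Proof. exact: loc_scaleA. Qed.

Lemma loc_mulC : commutative loc_mul.
Proof.
elim/fracW=> a s; elim/fracW=> b t.
rewrite /loc_mul !frac_scaleE; apply/fracP; exists denom1; rewrite /= ?denM ?den1.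
by rewrite /GRing.scale /=; ring.
Qed.

Lemma loc_mul1 : left_id loc_one loc_mul.
Proof. exact: loc_scale1. Qed.

Lemma loc_mulDl : left_distributive loc_mul +%R.
Proof. by move=> a b c; rewrite /loc_mul loc_scaleDl. Qed.

Lemma loc_one_neq0 : loc_one != 0.
Proof.
apply/eqP => /fracP[u]; rewrite den1 !scale1r scaler0 => e.
have eu : den u = 0 by rewrite -[den u]mulr1; exact: e.
by have := denP u; rewrite eu rpred0.
Qed.

HB.instance Definition _ := GRing.Zmodule_isComNzRing.Build locring
  loc_mulA loc_mulC loc_mul1 loc_mulDl loc_one_neq0.

HB.instance Definition _ (M : lmodType R) :=
  GRing.Zmodule_isLmodule.Build locring (locmod M)
    (@loc_scaleA M) (@loc_scale1 M) (@loc_scaleDr M) (@loc_scaleDl M).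

(* The maximal ideal p R_p of R_p. *)
Definition loc_max : pred locring :=
  fun z => `[< exists (a : R) (s : denom), a \in p /\ z = frac (a : R^o) s >].

End Localization.

Section PrimeIdeals.
Variable R : comNzRingType.

Definition ideal_pred (I : idealr R) : pred R^o := fun x => (x : R) \in I.
Lemma ideal_pred_closed I : submod_closed (ideal_pred I).
Proof.
split=> [|a x y Ix Iy]; first exact: (rpred0 I).
exact: (rpredD (idealMr a Ix) Iy).
Qed.
HB.instance Definition _ I :=
  GRing.isSubmodClosed.Build R R^o (ideal_pred I) (ideal_pred_closed I).
Definition ideal_submod (I : idealr R) : submodClosed R^o :=
  GRing.SubmodClosed.clone R R^o (ideal_pred I) _.

(* R / p as an R-module *)
Definition residue (p : prime_idealr R) : lmodType R := quotmod (ideal_submod p).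

(* Elements of [idealr R] are proper ideals. *)
Definition maximal_ideal (I : idealr R) : Prop :=
  forall J : idealr R, {subset I <= J} -> {subset J <= I}.

Definition is_local (m : idealr R) : Prop :=
  maximal_ideal m /\ forall I : idealr R, maximal_ideal I -> I =i m.

Definition noetherian : Prop :=
  forall I : submodClosed R^o, exists xs : seq R, I =i seq_mul R^o xs.

Definition prime_lt (p q : prime_idealr R) : Prop :=
  {subset p <= q} /\ ~ {subset q <= p}.

Definition minimal_in (X : prime_idealr R -> Prop) (p : prime_idealr R) : Prop :=
  X p /\ forall q, X q -> {subset q <= p} -> {subset p <= q}.

Section Modules.
Variable M : lmodType R.

Definition supp (p : prime_idealr R) : Prop := exists z : locmod p M, z <> 0.

(* The supremum of the lengths of chains of primes in Supp M; [-oo] if M = 0. *)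
Definition krull_dim : \bar nat := chain_sup prime_lt supp.

Definition regular_seq (xs : seq R) : Prop :=
  (forall i, (i < size xs)%N -> forall z : quotmod (seq_mul M (take i xs)),
     xs`_i *: z = 0 -> z = 0) /\
  (exists z : quotmod (seq_mul M xs), z <> 0).

(* By Rees' theorem all maximal M-regular sequences in the maximal ideal of a
   Noetherian local ring have this length, for M <> 0 finitely generated. *)
Definition depth (m : pred R) : \bar nat :=
  nat_sup (fun n => exists xs : seq R,
    [/\ size xs = n, {subset xs <= m} & regular_seq xs]).

(* Meant for [M] finitely generated over a Noetherian local ring with maximal
   ideal [m]. *)
Definition cohen_macaulay (m : pred R) : Prop :=
  (forall x : M, x = 0) \/ depth m = krull_dim.

Definition sys_param (m : pred R) (xs : seq R) : Prop :=
  [/\ {subset xs <= m}, krull_dim = (size xs)%:E%E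
    & mod_length (quotmod (seq_mul M xs)) <> +oo%E].

End Modules.
End PrimeIdeals.

Definition cohen_macaulay_at (R : comNzRingType) (M : lmodType R)
    (p : prime_idealr R) : Prop :=
  cohen_macaulay (locmod p M) (@loc_max R p).

Definition cohen_macaulay_ring (R : comNzRingType) : Prop :=
  noetherian R /\
  forall p : prime_idealr R, maximal_ideal p ->
    cohen_macaulay (locring p)^o (@loc_max R p).

Section Serre.
Variable R : comNzRingType.

Definition short_exact (L M N : lmodType R)
    (f : {linear L -> M}) (g : {linear M -> N}) : Prop :=
  [/\ injective f, forall y, exists x, g x = y
    & forall y, g y = 0 <-> exists x, f x = y].

Variable S : lmodType R -> Prop.

Definition serre_class : Prop :=
  (exists M, S M) /\
  forall (L M N : lmodType R) (f : {linear L -> M}) (g : {linear M -> N}),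
    short_exact f g -> (S M <-> S L /\ S N).

Variable M : lmodType R.

Definition weak_seq (xs : seq R) : Prop :=
  forall i, (i < size xs)%N ->
    S (subquot (colon (seq_mul M (take i xs)) xs`_i) (seq_mul M (take i xs))).

Definition serre_cohen_macaulay (m : pred R) : Prop :=
  forall xs : seq R, sys_param M m xs -> weak_seq xs.

Definition serre_supp (p : prime_idealr R) : Prop :=
  supp M p /\ ~ S (residue p).

End Serre.

(* Main.v *)
(* Let X be the set of primes p with R/p outside S.  It is stable under
   generization, and a finitely generated module lies in S if and only if its
   support avoids X.  So M is S-Cohen-Macaulay if and only if every system of
   parameters of M becomes weakly regular on M_p for all p in X, and R/a lies in
   S if and only if M_p is Cohen-Macaulay for all p in X.

   (i) => (ii): for p in X and in Supp M, some system of parameters of M starts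
   with dim M - dim R/p elements of p.  They form a regular sequence on M_p, so
   M_p is Cohen-Macaulay of dimension dim M - dim R/p, and this is 0 when p is
   minimal.

   (ii) => (i): for x_1, ..., x_i in p, the dimension formula
   dim R/q = ht(p/q) + dim R/p, valid in a quotient of a Cohen-Macaulay ring, shows
   that x_1, ..., x_i cut the dimension of M_p down by i.  In a Cohen-Macaulay
   module such a sequence is regular.

   Modules over R_p are avoided: M/U localized at p is replaced by the pair of the
   submodule U of M and its p-saturation in M. *)
Require Import Defs.
From HB Require Import structures.
From mathcomp Require Import all_boot all_order all_algebra.
From mathcomp Require Import ring zify.
From mathcomp Require Import boolp classical_sets constructive_ereal.

Set Implicit Arguments.
Unset Strict Implicit.
Unset Printing Implicit Defensive.

(* [Defs] again, for its [frac]. *)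
Import GRing.Theory Defs.
Local Open Scope classical_set_scope.
Local Open Scope ring_scope.

(** * Linear identities in modules *)

(** Depth and dimension enter only as existence statements: [has_reg_seq] bounds the depth from
    below, [chain] bounds the dimension from below, and an upper bound is a negated [chain]. This
    suffices because a regular sequence is never longer than the dimension: a nonzero module is
    Cohen-Macaulay once a single r bounds its depth from below and its dimension from above. The
    obstacle is that depth must not depend on the chosen sequence: an element x lowering the
    dimension of a Cohen-Macaulay module has to leave a Cohen-Macaulay quotient, although the given
    regular sequence need not begin with x. Prime avoidance supplies an element to exchange through,
    in place of a homological description of depth. The dimension formula has the same source: for A
    Cohen-Macaulay and local, dim A_q = dim A - dim A/q, and reaching A_q directly or through A_p
    must give the same value; preimages carry the formula to R. In the converse it is applied to the
    head q of a longest chain in Supp M ending at p. By generization q is minimal in the S-support,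
    so dim R/q = dim M. *)

(* The square-zero extension R (+) M, in which [ring] decides the linear
   identities of M. *)
Section SquareZero.
Variables (R : comNzRingType) (M : lmodType R).

Definition sqzero := (R * M)%type.
HB.instance Definition _ := GRing.Zmodule.on sqzero.

Definition sqzero_mul (u v : sqzero) : sqzero :=
  (u.1 * v.1, u.1 *: v.2 + v.1 *: u.2).

Fact sqzero_mulA : associative sqzero_mul.
Proof.
move=> [a x] [b y] [c z]; congr pair; rewrite /= ?mulrA //.
rewrite !scalerDr !scalerA addrA; congr (_ + _ *: _ + _ *: _).
  by rewrite mulrC.
by rewrite [b * c]mulrC.
Qed.

Fact sqzero_mulC : commutative sqzero_mul.
Proof. by move=> [a x] [b y]; congr pair; rewrite /= 1?mulrC 1?addrC. Qed.

Fact sqzero_mul1 : left_id (1, 0) sqzero_mul.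
Proof. by move=> [a x]; rewrite /sqzero_mul /= mul1r scale1r scaler0 addr0. Qed.

Fact sqzero_mulDl : left_distributive sqzero_mul +%R.
Proof.
move=> [a x] [b y] [c z]; congr pair; rewrite /= ?mulrDl //.
by rewrite scalerDl scalerDr addrACA.
Qed.

Fact sqzero_one_neq0 : (1, 0) != 0 :> sqzero.
Proof. by apply/eqP => -[/eqP]; rewrite oner_eq0. Qed.

HB.instance Definition _ := GRing.Zmodule_isComNzRing.Build sqzero
  sqzero_mulA sqzero_mulC sqzero_mul1 sqzero_mulDl sqzero_one_neq0.

Definition sqzero_scalar (a : R) : sqzero := (a, 0).

Fact sqzero_scalar_additive : zmod_morphism sqzero_scalar.
Proof. by move=> a b; rewrite /sqzero_scalar; congr pair; rewrite /= subr0. Qed.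
Fact sqzero_scalar_multiplicative : monoid_morphism sqzero_scalar.
Proof. by split=> // a b; congr pair; rewrite /= !scaler0 addr0. Qed.
HB.instance Definition _ := GRing.isZmodMorphism.Build R sqzero sqzero_scalar
  sqzero_scalar_additive.
HB.instance Definition _ := GRing.isMonoidMorphism.Build R sqzero sqzero_scalar
  sqzero_scalar_multiplicative.

Definition sqzero_vec (x : M) : sqzero := (0, x).

Lemma sqzero_vec_inj : injective sqzero_vec. Proof. by move=> x y []. Qed.
Lemma sqzero_vec0 : sqzero_vec 0 = 0. Proof. by []. Qed.
Lemma sqzero_vecD x y : sqzero_vec (x + y) = sqzero_vec x + sqzero_vec y.
Proof. by congr pair; rewrite /= addr0. Qed.
Lemma sqzero_vecN x : sqzero_vec (- x) = - sqzero_vec x.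
Proof. by congr pair; rewrite /= oppr0. Qed.
Lemma sqzero_vecZ a x : sqzero_vec (a *: x) = sqzero_scalar a * sqzero_vec x.
Proof. by congr pair; rewrite /= ?mulr0 // scale0r addr0. Qed.

Definition sqzero_vecE := (sqzero_vec0, sqzero_vecD, sqzero_vecN, sqzero_vecZ).
End SquareZero.

Ltac module := apply: sqzero_vec_inj; rewrite !sqzero_vecE; ring.

(** * Submodules and the Noetherian condition *)

Section Submodule.
Variables (R : comNzRingType) (M : lmodType R).
Implicit Types (U V W : set M) (a b s : R) (x y z : M) (l : seq M).

(** Bare sets, because those with the same elements are then equal and can be rewritten, as in
    [addmulAC], and no closure proof travels with the operations. *)
Definition subm U := U 0 /\ forall a x y, U x -> U y -> U (a *: x + y).

Section Closure.
Variables (U : set M) (sU : subm U).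

Lemma submD x y : U x -> U y -> U (x + y).
Proof. by move=> Ux Uy; rewrite -[x]scale1r; apply: sU.2. Qed.

Lemma submZ a x : U x -> U (a *: x).
Proof. by move=> Ux; rewrite -[_ *: _]addr0; apply: sU.2 => //; exact: sU.1. Qed.

Lemma submB x y : U x -> U y -> U (x - y).
Proof. by move=> Ux Uy; rewrite addrC -scaleN1r; apply: sU.2. Qed.

End Closure.

Lemma subm0 : subm [set 0].
Proof. by split=> // a x y -> ->; rewrite scaler0 addr0. Qed.

(* [U + R z] and [U + x M] *)
Definition adjoin U z : set M := fun y => exists a, U (y - a *: z).
Definition addmul U (x : R) : set M := fun y => exists z, U (y - x *: z).

Lemma subm_adjoin U z : subm U -> subm (adjoin U z).
Proof.
move=> sU; split=> [|a x y [b Ub] [c Uc]].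
  by exists 0; rewrite scale0r subr0; exact: sU.1.
exists (a * b + c).
have -> : a *: x + y - (a * b + c) *: z = a *: (x - b *: z) + (y - c *: z).
  by module.
exact: sU.2.
Qed.

Lemma subm_addmul U (x : R) : subm U -> subm (addmul U x).
Proof.
move=> sU; split=> [|a y z [v Uv] [w Uw]].
  by exists 0; rewrite scaler0 subr0; exact: sU.1.
exists (a *: v + w).
have -> : a *: y + z - x *: (a *: v + w) = a *: (y - x *: v) + (z - x *: w).
  by module.
exact: sU.2.
Qed.

Lemma sub_adjoin U z : U `<=` adjoin U z.
Proof. by move=> y Uy; exists 0; rewrite scale0r subr0. Qed.

Lemma mem_adjoin U z : subm U -> adjoin U z z.
Proof. by move=> sU; exists 1; rewrite scale1r subrr; exact: sU.1. Qed.

Lemma adjoin_min U V z : subm V -> U `<=` V -> V z -> adjoin U z `<=` V.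
Proof.
move=> sV UV Vz y [a /UV Va]; rewrite -[y](subrK (a *: z)).
by apply: submD => //; apply: submZ.
Qed.

Lemma sub_addmul U (x : R) : U `<=` addmul U x.
Proof. by move=> y Uy; exists 0; rewrite scaler0 subr0. Qed.

Lemma mul_addmul U (x : R) z : subm U -> addmul U x (x *: z).
Proof. by move=> sU; exists z; rewrite subrr; exact: sU.1. Qed.

Lemma addmulAC U (x y : R) : addmul (addmul U x) y = addmul (addmul U y) x.
Proof.
by rewrite predeqE => z; split=> -[u [v h]]; exists v; exists u; rewrite addrAC.
Qed.

Fixpoint lspan l : set M :=
  if l is z :: l' then adjoin (lspan l') z else [set 0].

Lemma subm_lspan l : subm (lspan l).
Proof.
elim: l => [|z l IH] /=; last exact: subm_adjoin.
by split=> // a x y -> ->; rewrite scaler0 addr0.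
Qed.

Lemma lspan_min l U : subm U -> {in l, forall z, U z} -> lspan l `<=` U.
Proof.
move=> sU; elim: l => [|z l IH] /= h; first by move=> _ ->; exact: sU.1.
apply: adjoin_min => //; last by apply: h; rewrite mem_head.
by apply: IH => y yl; apply: h; rewrite in_cons yl orbT.
Qed.

Lemma mem_lspan l z : z \in l -> lspan l z.
Proof.
elim: l => [|y l IH] //=; rewrite in_cons => /orP[/eqP->|/IH].
  by apply: mem_adjoin; exact: subm_lspan.
exact: sub_adjoin.
Qed.

(** The maximal condition is the form that Noetherian induction consumes; [noeth_lspan] and
    [noeth_of_lspan] translate to and from finite generation. *)
Definition noeth_mod := forall F : set (set M), (exists2 U, subm U & F U) ->
  exists U, [/\ subm U, F U & forall V, subm V -> F V -> U `<=` V -> V `<=` U].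

Lemma noeth_lspan U : noeth_mod -> subm U -> exists l, U = lspan l.
Proof.
move=> nM sU.
have [|_ [_ [l -> lU] maxl]] :=
    nM [set V | exists2 l, V = lspan l & {in l, forall z, U z}].
  by exists (lspan [::]); [exact: subm_lspan | exists [::]].
exists l; rewrite eqEsubset; split; last exact: lspan_min.
move=> z Uz; apply: (maxl (lspan (z :: l))); first exact: subm_lspan.
- by exists (z :: l) => // y; rewrite in_cons => /orP[/eqP->|/lU].
- exact: sub_adjoin.
- exact/mem_lspan/mem_head.
Qed.

(** Without a maximal member, choice iterates strict enlargements inside [F]. Their union is
    finitely generated, so one stage already contains it and cannot be enlarged. *)
Lemma noeth_of_lspan : (forall U, subm U -> exists l, U = lspan l) -> noeth_mod.
Proof.
move=> fg F [U0 sU0 FU0]; apply: contrapT => nomax.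
pose T := {U | subm U /\ F U}.
have step (u : T) : exists v : T, sval u `<=` sval v /\ ~ sval v `<=` sval u.
  apply: contrapT => nov; apply: nomax; exists (sval u).
  have [sU FU] := svalP u; split=> // V sV FV UV; apply: contrapT => nVU.
  by apply: nov; exists (exist _ V (conj sV FV)).
have [f fP] := choice step.
pose u n := iter n f (exist _ U0 (conj sU0 FU0) : T).
have u_mono i j : (i <= j)%N -> sval (u i) `<=` sval (u j).
  move=> /subnK <-; elim: (j - i)%N => [|k IH] //=.
  by apply: subset_trans IH _; exact: (fP (u (k + i)%N)).1.
pose V : set M := fun z => exists n, sval (u n) z.
have sV : subm V.
  split; first by exists 0%N; exact: sU0.1.
  move=> a x y [i ux] [j uy]; exists (maxn i j); apply: (svalP (u _)).1.2.
    by apply: u_mono ux; exact: leq_maxl.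
  by apply: u_mono uy; exact: leq_maxr.
have [l lV] := fg V sV.
have [n un] : exists n, {in l, forall z, sval (u n) z}.
  have : {in l, forall z, V z} by move=> z /mem_lspan; rewrite -lV.
  elim: (l) => [|z l' IH] h; first by exists 0%N.
  have [n un] := IH (fun y yl => h y (mem_behead (s := z :: l') yl)).
  have [k uk] := h z (mem_head _ _).
  exists (maxn n k) => y; rewrite in_cons => /orP[/eqP->|/un].
    by apply: u_mono uk; exact: leq_maxr.
  by apply: u_mono; exact: leq_maxl.
apply: (fP (u n)).2 => z uz; apply: (lspan_min (svalP (u n)).1 un).
by rewrite -lV; exists n.+1.
Qed.

Lemma subm_sum U (I : Type) (r : seq I) (P : pred I) (F : I -> M) : subm U ->
  (forall i, P i -> U (F i)) -> U (\sum_(i <- r | P i) F i).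
Proof. by move=> sU UF; apply: big_ind => //; [exact: sU.1 | exact: submD]. Qed.

(* [U + (x_1, ..., x_n) M] *)
Fixpoint mulseq U (xs : seq R) : set M :=
  if xs is x :: xs' then mulseq (addmul U x) xs' else U.

Lemma subm_mulseq U xs : subm U -> subm (mulseq U xs).
Proof. by elim: xs U => //= c xs IH U sU; apply: IH; exact: subm_addmul. Qed.

Lemma sub_mulseq U xs : U `<=` mulseq U xs.
Proof. by elim: xs U => [|c xs IH] U z Uz //=; apply: IH; exact: sub_addmul. Qed.

Lemma mem_mulseq U xs (c : R) z : subm U -> c \in xs -> mulseq U xs (c *: z).
Proof.
elim: xs U => //= d xs IH U sU; rewrite in_cons => /orP[/eqP->|cxs].
  by apply: sub_mulseq; exact: mul_addmul.
by apply: IH => //; exact: subm_addmul.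
Qed.

Lemma mulseqP U xs z : mulseq U xs z <->
  exists y : nat -> M, U (z - \sum_(j < size xs) xs`_j *: y j).
Proof.
elim: xs U z => [|c xs IH] U z /=.
  by split=> [Uz|[y]]; [exists (fun=> 0)|]; rewrite big_ord0 subr0.
split=> [/IH[y [w h]]|[y]].
  exists (fun n => if n is k.+1 then y k else w).
  by rewrite big_ord_recl /= opprD addrA addrAC.
rewrite big_ord_recl /= => h; apply/IH; exists (fun n => y n.+1); exists (y 0%N).
by move: h; rewrite opprD addrA addrAC.
Qed.

Lemma mulseq_cat U xs ys : mulseq U (xs ++ ys) = mulseq (mulseq U xs) ys.
Proof. by elim: xs U => //= x xs IH U. Qed.

Lemma mem_seq_mul xs z : (z \in seq_mul M xs) = mulseq [set 0] xs z :> Prop.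
Proof.
rewrite propeqE mulseqP; split=> [/asboolP[y ->]|[y h]].
  exists (fun n => oapp y 0 (insub n)); apply/eqP; rewrite subr_eq0; apply/eqP.
  by apply: eq_bigr => j _; rewrite valK.
by apply/asboolP; exists (fun j => y j); apply/eqP; rewrite -subr_eq0; apply/eqP.
Qed.

Fact mk_submod_subproof U : subm U -> submod_closed (fun x => `[< U x >]).
Proof.
move=> sU; split=> [|a x y /asboolP Ux /asboolP Uy]; apply/asboolP.
  exact: sU.1.
exact: sU.2.
Qed.

Definition mk_submod U (sU : subm U) : submodClosed M :=
  HB.pack_for (submodClosed M) (fun x => `[< U x >])
    (GRing.isSubmodClosed.Build R M _ (mk_submod_subproof sU)).

Lemma mem_mk_submod U (sU : subm U) x : (x \in mk_submod sU) = U x :> Prop.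
Proof. by rewrite propeqE; split=> /asboolP. Qed.

Lemma subm_submod (U : submodClosed M) : subm [set x | x \in U].
Proof.
split=> [|a x y Ux Uy]; first exact: (rpred0 U).
by apply: rpredD => //; apply: rpredZ; exact: Ux.
Qed.

(** With [V] spanned by the other generators, this is the ideal of coefficients at [x] of the
    elements of [U], in the role of the leading coefficients in Hilbert's basis theorem. *)
Definition image_coef U V x : set R^o :=
  fun a => exists2 v, V v & U (a *: x + v).

End Submodule.

Lemma subm_coef (R : comNzRingType) (M : lmodType R) (U V : set M) (x : M) :
  subm U -> subm V -> subm (image_coef U V x).
Proof.
move=> sU sV; split=> [|c a b [v Vv Uv] [w Vw Uw]].
  by exists 0; rewrite ?scale0r ?addr0; [exact: sV.1 | exact: sU.1].
exists (c *: v + w); first exact: sV.2.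
have -> : (c *: a + b : R^o) *: x + (c *: v + w) =
          c *: ((a : R) *: x + v) + ((b : R) *: x + w).
  by rewrite /GRing.scale /=; module.
exact: sU.2.
Qed.

(** Induction on the generators: two elements of [U] with the same coefficient at [x] differ by an
    element of [U] in [lspan l]. So lifts of generators of the coefficient ideal, together with
    generators of that intersection, generate [U]. *)
Lemma noeth_fin_gen (R : comNzRingType) (M : lmodType R) :
  noetherian R -> fin_gen M -> noeth_mod M.
Proof.
move=> nR [g gM].
have idfg (I : set R^o) : subm I -> exists l, I = lspan l.
  move=> sI; have [xs Ixs] := nR (mk_submod sI); exists xs.
  rewrite eqEsubset; split=> [a|].
    rewrite -(mem_mk_submod sI) Ixs => /asboolP[y ->].
    apply: subm_sum => [|j _]; first exact: subm_lspan.
    rewrite /GRing.scale /= mulrC; apply: submZ; first exact: subm_lspan.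
    exact/mem_lspan/mem_nth.
  apply: lspan_min => // a axs; rewrite -(mem_mk_submod sI) Ixs mem_seq_mul.
  rewrite -[a]mulr1; apply: mem_mulseq => //.
  exact: subm0.
have sg : lspan g = setT.
  rewrite predeqE => x; split=> // _; have [c ->] := gM x.
  apply: subm_sum => [|j _]; first exact: subm_lspan.
  by apply: submZ; [exact: subm_lspan | exact/mem_lspan/mem_nth].
suff fg (l : seq M) U : subm U -> U `<=` lspan l -> exists l', U = lspan l'.
  by apply: noeth_of_lspan => U sU; apply: (fg g) => //; rewrite sg.
elim: l U => [|x l IH] U sU Ul.
  exists [::]; rewrite eqEsubset; split=> // z ->; exact: sU.1.
have [as_ Ias] := idfg _ (subm_coef x sU (subm_lspan l)).
have /choice[u uP] : forall a : R, exists u, a \in as_ -> U u /\ lspan l (u - a *: x).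
  move=> a; have [|/negP nin] := boolP (a \in as_); last by exists 0.
  move=> /mem_lspan; rewrite -Ias => -[v lv Uv].
  by exists (a *: x + v) => _; split=> //; rewrite addrAC subrr add0r.
have [||l' ll'] := IH [set z | U z /\ lspan l z].
- split; first by split; [exact: sU.1 | exact: (subm_lspan l).1].
  by move=> a y z [Uy ly] [Uz lz]; split; [exact: sU.2 | exact: (subm_lspan l).2].
- by move=> z [].
have Ul' : lspan l' `<=` U by rewrite -ll' => z [].
exists (map u as_ ++ l'); rewrite eqEsubset; split; last first.
  apply: lspan_min => // z; rewrite mem_cat => /orP[/mapP[a /uP[Uu _] ->]//|/mem_lspan].
  exact: Ul'.
set V := lspan _; have sV : subm V by exact: subm_lspan.
have V_u a : a \in as_ -> V (u a).
  by move=> aas; apply: mem_lspan; rewrite mem_cat map_f.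
have VU : V `<=` U.
  apply: lspan_min => // z; rewrite mem_cat => /orP[/mapP[a /uP[Uu _] ->]//|/mem_lspan].
  exact: Ul'.
have l'V : lspan l' `<=` V.
  by apply: lspan_min => // z zl'; apply: mem_lspan; rewrite mem_cat zl' orbT.
move=> z Uz; have [a la] := Ul z Uz.
have [v lv Vv] : image_coef V (lspan l) x a.
  suff : lspan as_ `<=` image_coef V (lspan l) x.
    by apply; rewrite -Ias; exists (z - a *: x) => //; rewrite subrKC.
  apply: lspan_min; first exact: subm_coef sV (subm_lspan l).
  move=> b bas; have [_ lb] := uP b bas; exists (u b - b *: x) => //.
  by rewrite subrKC; exact: V_u.
rewrite -[z](subrK (a *: x + v)); apply: submD => //; apply: l'V.
rewrite -ll'; split; first by apply: submB => //; exact: VU.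
by rewrite opprD addrA; apply: submB => //; exact: subm_lspan.
Qed.

(** * Saturation, associated primes and Nakayama's lemma *)

Section Primes.
Variable R : comNzRingType.

Definition is_prime (q : set R) :=
  [/\ @subm R R^o q, ~ q 1 & forall a b, q (a * b) -> q a \/ q b].

Section Closure.
Variables (q : set R) (pq : is_prime q).

Lemma prime_subm : @subm R R^o q. Proof. by case: pq. Qed.
Lemma prime0 : q 0. Proof. exact: prime_subm.1. Qed.
Lemma prime1 : ~ q 1. Proof. by case: pq. Qed.
Lemma primeD a b : q a -> q b -> q (a + b).
Proof. exact: (submD prime_subm). Qed.
Lemma primeB a b : q a -> q b -> q (a - b).
Proof. exact: (submB prime_subm). Qed.
Lemma primeMl a b : q b -> q (a * b).
Proof. exact: (submZ prime_subm). Qed.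
Lemma primeMr a b : q a -> q (a * b).
Proof. by rewrite mulrC; exact: primeMl. Qed.
Lemma primeNM a b : ~ q a -> ~ q b -> ~ q (a * b).
Proof. by case: pq => _ _ qM na nb /qM[]. Qed.

End Closure.
End Primes.

Section Saturation.
Variables (R : comNzRingType) (M : lmodType R).
Implicit Types (U V W : set M) (p q : set R) (x y z : M).

(* The preimage in M of the localization [U_q] of a submodule [U]. *)
Definition sat q U : set M := fun z => exists2 s, ~ q s & U (s *: z).

(** The annihilators of the class of [z] in M/U and, next, of M/U itself. A prime
    [transporter (sat p U) z] is an associated prime of the localization of M/U at p, seen in R. *)
Definition transporter U z : set R := [set a | U (a *: z)].
Definition ann U : set R := [set a | forall z, U (a *: z)].

Lemma subm_transporter U z : subm U -> @subm R R^o (transporter U z).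
Proof.
move=> sU; split=> [|a b c Ub Uc]; rewrite /transporter /= ?scale0r; first exact: sU.1.
by rewrite scalerDl -[a *: b]/(a * (b : R)) -scalerA; exact: sU.2.
Qed.

Lemma subm_ann U : subm U -> @subm R R^o (ann U).
Proof.
move=> sU; split=> [z|a b c Ub Uc z]; first by rewrite scale0r; exact: sU.1.
by rewrite scalerDl -[a *: b]/(a * (b : R)) -scalerA; exact: sU.2.
Qed.

Lemma ann_sub U V : U `<=` V -> ann U `<=` ann V.
Proof. by move=> UV a h z; exact/UV/h. Qed.

Lemma ann_addmul U (x : R) : subm U -> ann (addmul U x) x.
Proof. by move=> sU z; exact: mul_addmul. Qed.

Section Fixed.
Variables (q : set R) (pq : is_prime q).

Lemma sub_sat U : U `<=` sat q U.
Proof. by move=> z Uz; exists 1; [exact: (prime1 pq) | rewrite scale1r]. Qed.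

Lemma subm_sat U : subm U -> subm (sat q U).
Proof.
move=> sU; split=> [|a x y [s ns Us] [t nt Ut]].
  exact/sub_sat/sU.1.
exists (s * t); first exact: primeNM.
have -> : (s * t) *: (a *: x + y) = (t * a) *: (s *: x) + s *: (t *: y) by module.
by apply: sU.2 => //; apply: submZ.
Qed.

Lemma sat_sub U V : U `<=` V -> sat q U `<=` sat q V.
Proof. by move=> UV z [s ns /UV]; exists s. Qed.

Lemma sat_sat U : sat q (sat q U) `<=` sat q U.
Proof.
move=> z [s ns [t nt Ut]]; exists (t * s); first exact: primeNM.
by rewrite -scalerA.
Qed.

Lemma sat_cancel U s z : ~ q s -> sat q U (s *: z) -> sat q U z.
Proof. by move=> ns h; apply: sat_sat; exists s. Qed.

Lemma transporter_sat_sub U z : ~ sat q U z -> transporter (sat q U) z `<=` q.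
Proof. by move=> nz a; apply: contraPP => na /(sat_cancel na). Qed.

End Fixed.

Lemma sat_antitone p q U : q `<=` p -> sat p U `<=` sat q U.
Proof. by move=> qp z [s ns Us]; exists s => // /qp. Qed.

(** An ideal maximal among the annihilators of the nonzero multiples of [z] is prime: if c d kills b
    z and d does not, the annihilator of d b z contains c and, by maximality, is no larger. *)
Lemma exists_assoc U z : noeth_mod R^o -> subm U -> ~ U z ->
  exists b, is_prime (transporter U (b *: z)).
Proof.
move=> nR sU nUz.
have [|I [sI [b nb defI] maxb]] :=
    nR [set I | exists2 b, ~ U (b *: z) & I = transporter U (b *: z)].
  exists (transporter U (1 *: z)); first exact: subm_transporter.
  by exists 1; rewrite ?scale1r.
subst I; exists b; split=> //; first by rewrite /transporter /= scale1r.
move=> c d; rewrite /transporter /= => Ucd; apply: contrapT => /not_orP[nc nd].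
apply: nc; apply: (maxb (transporter U ((d * b) *: z))) => /=.
- exact: subm_transporter.
- by exists (d * b) => //; rewrite -scalerA.
- move=> e; rewrite /transporter /= => Ue.
  have -> : e *: ((d * b) *: z) = d *: (e *: (b *: z)) by module.
  exact: submZ.
- by rewrite /transporter /= -[(d * b) *: z]scalerA (scalerA c d).
Qed.

Lemma exists_assoc_sat p U z : noeth_mod R^o -> is_prime p -> subm U ->
  ~ sat p U z -> exists b, [/\ is_prime (transporter (sat p U) (b *: z)),
    transporter (sat p U) (b *: z) `<=` p & ann U `<=` transporter (sat p U) (b *: z)].
Proof.
move=> nR pp sU nz; have [b pb] := exists_assoc nR (subm_sat pp sU) nz.
exists b; split=> //; last by move=> a aU; exact/sub_sat/aU.
apply: transporter_sat_sub => // h; apply: (prime1 pb).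
by rewrite /transporter /= scale1r.
Qed.

(** The hypothesis puts U into V + x U at p. Generators y of [U] are removed one by one: s0 y = x u
    and t u has coefficient a at y, so (t s0 - x a) y is in the span of the others, and this factor
    is outside [p] because x is in [p] and t s0 is not. *)
Lemma nakayama p V U (x : R) : noeth_mod M -> is_prime p -> p x ->
    subm V -> subm U ->
    (forall z, U z ->
       exists2 s, ~ p s & exists2 u, U u & sat p V (s *: z - x *: u)) ->
  U `<=` sat p V.
Proof.
move=> nM pp px sV sU; set W := sat p V => hU.
have sW : subm W by exact: subm_sat.
have Wc s z : ~ p s -> W (s *: z) -> W z by exact: sat_cancel.
have [l lU] := noeth_lspan nM sU.
suff claim l' : lspan l' `<=` U ->
    (forall z, U z -> exists2 s, ~ p s & exists2 w, lspan l' w & W (s *: z - w)) ->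
    U `<=` W.
  apply: (claim l); rewrite lU // => z lz; exists 1; first exact: (prime1 pp).
  by exists z => //; rewrite scale1r subrr; exact: sW.1.
elim: l' => [|y l' IH] l'U h.
  move=> z /h[s ns [w ->]]; rewrite subr0; exact: Wc.
have Uy : U y by apply: l'U; apply: mem_lspan; exact: mem_head.
have [s0 ns0 [u Uu Wu]] := hU y Uy; have [t nt [w [a lw] Ww]] := h u Uu.
have nr : ~ p (t * s0 - x * a).
  move=> pr; apply: (primeNM pp nt ns0); rewrite -[t * s0](subrK (x * a)).
  by apply: primeD => //; exact: primeMr.
apply: IH => [z l'z|z Uz]; first by apply: l'U; exact: sub_adjoin.
have [s ns [v [b lv] Wv]] := h z Uz.
exists (s * (t * s0 - x * a)); first exact: primeNM.
exists ((t * s0 - x * a) *: (v - b *: y) + (b * x) *: (w - a *: y)).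
  by apply: (subm_lspan l').2 => //; apply: submZ => //; exact: subm_lspan.
have -> : (s * (t * s0 - x * a)) *: z -
    ((t * s0 - x * a) *: (v - b *: y) + (b * x) *: (w - a *: y)) =
    (t * s0 - x * a) *: (s *: z - v) + (b * t) *: (s0 *: y - x *: u) +
    (b * x) *: (t *: u - w) by module.
by do 2?[apply: submD => //]; apply: submZ.
Qed.

(* The support of the finitely generated module [M/U] is [V (ann U)]. *)
Lemma supp_ann U q : noeth_mod M -> is_prime q -> subm U ->
  (exists z, ~ sat q U z) <-> ann U `<=` q.
Proof.
move=> nM pq sU; split=> [[z nz] a Ua|Uq].
  by apply: contrapT => na; apply: nz; exists a.
apply: contrapT => /forallNP h.
have hs z : sat q U z by apply: contrapT; exact: h.
have sT : subm (setT : set M) by [].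
have [l lT] := noeth_lspan nM sT.
suff [s ns ls] : exists2 s, ~ q s & forall z, lspan l z -> U (s *: z).
  by apply/ns/Uq => z; apply: ls; rewrite -lT.
elim: (l) => [|y l' [s ns IH]].
  exists 1; first exact: (prime1 pq).
  by move=> z ->; rewrite scaler0; exact: sU.1.
have [t nt Ut] := hs y; exists (s * t); first exact: primeNM.
move=> z [a /IH lz].
have -> : (s * t) *: z = t *: (s *: (z - a *: y)) + (s * a) *: (t *: y) by module.
by apply: submD => //; apply: submZ.
Qed.

(** On supports: Supp M/(U + x M) is the part of Supp M/U where x is not a unit. Nakayama excludes
    that M/U = x (M/U) at such a prime. *)
Lemma ann_addmul_sub U q (x : R) : noeth_mod M -> is_prime q -> subm U ->
  ann (addmul U x) `<=` q <-> ann U `<=` q /\ q x.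
Proof.
move=> nM pq sU; split=> [h|[Uq qx]].
  split; first exact: subset_trans (ann_sub (@sub_addmul _ _ U x)) h.
  exact/h/ann_addmul.
have [z nz] := (supp_ann nM pq sU).2 Uq.
apply/(supp_ann nM pq (subm_addmul x sU)); apply: contrapT => /forallNP h; apply: nz.
apply: (@nakayama q U setT x) => // y _.
have [s ns [u Uu]] := contrapT (h y); exists s => //; exists u => //.
exact: sub_sat.
Qed.

Lemma ann_mulseq_sub U q (xs : seq R) : noeth_mod M -> is_prime q -> subm U ->
  {in xs, forall c, q c} -> ann U `<=` q -> ann (mulseq U xs) `<=` q.
Proof.
move=> nM pq; elim: xs U => //= c xs IH U sU xsq Uq; apply: IH.
- exact: subm_addmul.
- by move=> d dxs; apply: xsq; rewrite in_cons dxs orbT.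
- by apply/(ann_addmul_sub _ nM pq sU); split=> //; apply: xsq; exact: mem_head.
Qed.

End Saturation.

(** * Chains of primes and Krull's principal ideal theorem *)

Section Chains.
Variable R : comNzRingType.
Implicit Types (I J p q : set R).

(* A chain of [n + 1] primes between [I] and [p].  Its last term is not recorded:
   it can be taken to be [p]. *)
Inductive chain p : set R -> nat -> Prop :=
| chain0 I : I `<=` p -> chain p I 0
| chainS I q J c n : is_prime q -> I `<=` q -> q `<=` J -> J c -> ~ q c ->
    chain p J n -> chain p I n.+1.

Lemma chain_top p I n : chain p I n -> I `<=` p.
Proof.
elim=> {I n} // I q J c n _ Iq qJ _ _ _ Jp.
exact: subset_trans (subset_trans Iq qJ) Jp.
Qed.

Lemma chain_sub p I J n : I `<=` J -> chain p J n -> chain p I n.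
Proof.
move=> IJ h; case: h IJ => {J n} [J Jp|J q K c n pq Jq qK Kc nc h] IJ.
  by apply: chain0; exact: subset_trans IJ Jp.
exact: (chainS pq (subset_trans IJ Jq) qK Kc nc h).
Qed.

Lemma chain_leq p I k n : (k <= n)%N -> chain p I n -> chain p I k.
Proof.
move=> /subnK <-; elim: (n - k)%N => // {}n IH h; apply: IH; move: h.
move En: (n.+1 + k)%N => m h; case: h En => // {}I q J c m' _ Iq qJ _ _ h [->].
by apply: chain_sub h; exact: subset_trans Iq qJ.
Qed.

Lemma chain_head p I n : is_prime p -> chain p I n ->
  exists q, [/\ is_prime q, I `<=` q, q `<=` p & chain p q n].
Proof.
move=> pp [{}I Ip|{}I q J c {}n pq Iq qJ Jc nc h].
  by exists p; split=> //; exact: chain0.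
exists q; split=> //; last exact: (chainS pq _ qJ Jc nc h).
exact: subset_trans qJ (chain_top h).
Qed.

Lemma chain_gap p I n : chain p I n.+1 ->
  exists q c, [/\ is_prime q, I `<=` q, q `<=` p, p c & ~ q c].
Proof.
move En: n.+1 => k h; case: h En => // {}I q J c {}n' pq Iq qJ Jc nc /chain_top Jp _.
by exists q, c; split=> //; [exact: subset_trans qJ Jp | exact: Jp].
Qed.

Lemma chain_cat m p I j k : chain p I j -> chain m p k -> chain m I (j + k).
Proof.
move=> h hk; elim: h => {I j} [I Ip|I q J c j pq Iq qJ Jc nc _ IH].
  exact: chain_sub hk.
exact: (chainS pq Iq qJ Jc nc IH).
Qed.

Lemma prime_avoidance p (qs : seq (set R)) : @subm R R^o p ->
    {in qs, forall q, is_prime q /\ ~ p `<=` q} ->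
  exists2 x, p x & {in qs, forall q, ~ q x}.
Proof.
move=> sp; have [n] := ubnP (size qs); elim: n qs => // n IH [|q qs] sz h.
  by exists 0 => //; exact: sp.1.
have [pq npq] := h q (mem_head _ _).
have qsP : {in qs, forall q', is_prime q' /\ ~ p `<=` q'}.
  by move=> q' q'qs; apply: h; rewrite in_cons q'qs orbT.
have [[q' q'qs q'q]|no] := EM (exists2 q', q' \in qs & q' `<=` q).
  have [||x px hx] := IH (q :: rem q' qs).
  - by rewrite /= size_rem // prednK //; case: (qs) q'qs.
  - move=> r; rewrite in_cons => /orP[/eqP->//|/mem_rem]; exact: qsP.
  exists x => // r; rewrite in_cons => /orP[/eqP->|rqs].
    by apply: hx; exact: mem_head.
  have [->|nr] := eqVneq r q'; first by move/q'q; apply: hx; exact: mem_head.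
  by apply: hx; rewrite in_cons (rem_mem nr) ?orbT.
have [//|//|x px hx] := IH qs.
have [qx|nqx] := EM (q x); last first.
  by exists x => // r; rewrite in_cons => /orP[/eqP->//|]; exact: hx.
(* If [x] avoids [qs] but lies in [q], it is corrected by [y], a product of an element of [p] and
   one of each prime of [qs], all chosen outside [q]. *)
have [y [py ny yqs]] : exists y, [/\ p y, ~ q y & {in qs, forall r, r y}].
  have : {in qs, forall r, is_prime r /\ ~ r `<=` q}.
    by move=> r rqs; split; [case: (qsP r rqs) | move=> rq; apply: no; exists r].
  elim: (qs) => [_|r rs IHr hr].
    by have [y [py nqy]] := nonsubset npq; exists y.
  have [|y [py ny yrs]] := IHr.
    by move=> r' r'rs; apply: hr; rewrite in_cons r'rs orbT.
  have [pr nrq] := hr r (mem_head _ _); have [z [rz nqz]] := nonsubset nrq.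
  exists (y * z); split=> [||r'].
  - by rewrite mulrC; exact: (submZ sp).
  - exact: primeNM.
  - rewrite in_cons => /orP[/eqP->|r'rs]; first exact: primeMl.
    apply: primeMr; last exact: yrs.
    by have [] := hr r'; rewrite // in_cons r'rs orbT.
exists (x + y); first exact: (submD sp).
move=> r; rewrite in_cons => /orP[/eqP->|rqs] qxy.
  by apply: ny; rewrite -[y](addKr x) addrC; exact: primeB.
have [pr _] := qsP r rqs.
by apply: (hx r rqs); rewrite -[x](addrK y); apply: primeB => //; exact: yqs.
Qed.

(** Noetherian induction: a maximal counterexample contains some a b but neither factor, and every
    prime above it contains a or b. The list contains all minimal primes of [I], possibly among
    others. *)
Lemma finite_minimal_primes I : noeth_mod R^o -> @subm R R^o I ->
  exists2 qs : seq (set R), {in qs, forall q, is_prime q /\ I `<=` q} &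
    forall q, is_prime q -> I `<=` q -> exists2 r, r \in qs & r `<=` q.
Proof.
move=> nR sI; pose good J := exists2 qs : seq (set R),
  {in qs, forall q, is_prime q /\ J `<=` q} &
  forall q, is_prime q -> J `<=` q -> exists2 r, r \in qs & r `<=` q.
apply: contrapT => nI.
have [|{}I [{}sI {}nI maxI]] := nR [set J | ~ good J]; first by exists I.
have good_adjoin a : ~ I a -> good (adjoin I (a : R^o)).
  move=> na; apply: contrapT => ngood; apply: na.
  apply: (maxI _ (subm_adjoin _ sI) ngood); first exact: sub_adjoin.
  exact: mem_adjoin.
apply: nI; have [I1|nI1] := EM (I 1).
  by exists [::] => // q pq Iq; case: (prime1 pq); exact: Iq.
have [pI|npI] := EM (is_prime I).
  exists [:: I] => [q|q _ Iq]; first by rewrite inE => /eqP->; split=> // t.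
  by exists I; rewrite ?inE.
have [a [b [Iab na nb]]] : exists a b, [/\ I (a * b), ~ I a & ~ I b].
  apply: contrapT => h; apply: npI; split=> // a b Iab.
  apply: contrapT => /not_orP[na nb].
  by apply: h; exists a, b.
have [qa qaP qaQ] := good_adjoin a na; have [qb qbP qbQ] := good_adjoin b nb.
exists (qa ++ qb) => [q|q pq Iq].
  rewrite mem_cat => /orP[/qaP|/qbP] [pq Iq]; split=> //;
  exact: subset_trans (@sub_adjoin _ _ I _) Iq.
have [_ _ /(_ a b (Iq _ Iab))[qa'|qb']] := pq.
  have [|r rqa rq] := qaQ q pq; first exact: adjoin_min (prime_subm pq) Iq qa'.
  by exists r; rewrite // mem_cat rqa.
have [|r rqb rq] := qbQ q pq; first exact: adjoin_min (prime_subm pq) Iq qb'.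
by exists r; rewrite // mem_cat rqb orbT.
Qed.

(* [x] avoids the primes at the head of a longest chain above some member of
   [Is], apart from those containing [p]. *)
Lemma exists_drop m p (Is : seq (set R)) : noeth_mod R^o ->
    is_prime m -> is_prime p -> {in Is, forall I, @subm R R^o I} ->
  exists2 x, p x & {in Is, forall I, forall J k e, I `<=` J -> J x ->
    (e <= k)%N -> ~ chain m p e.+1 -> ~ chain m I k.+2 -> ~ chain m J k.+1}.
Proof.
move=> nR pm pp sIs.
have /choice[qs qsP] : forall I, exists qs : seq (set R), I \in Is ->
    {in qs, forall q, is_prime q /\ I `<=` q} /\
    forall q, is_prime q -> I `<=` q -> exists2 r, r \in qs & r `<=` q.
  move=> I; have [/sIs sI|//] := boolP (I \in Is); last by exists [::].
  by have [qs] := finite_minimal_primes nR sI; exists qs.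
have [||x px hx] := @prime_avoidance p
    [seq q <- flatten (map qs Is) | `[< ~ p `<=` q >]].
  - exact: prime_subm.
  - move=> q; rewrite mem_filter => /andP[/asboolP npq] /flattenP[l].
    by move=> /mapP[I IIs ->] /(qsP I IIs).1[].
exists x => // I IIs J k e IJ Jx ek np nI /(chain_head pm)[q [pq Jq qm hq]].
have [q0 q0qs q0q] := (qsP I IIs).2 q pq (subset_trans IJ Jq).
have [pq0 Iq0] := (qsP I IIs).1 q0 q0qs.
(* A prime above [p] only starts chains of length at most [e], hence at most [k], so it does no harm
   that [x] lies in it. *)
have [pq0'|npq0] := EM (p `<=` q0).
  apply: np; apply: chain_leq (ek : e < k.+1)%N _.
  exact: chain_sub (subset_trans pq0' q0q) hq.
(* Here [x] is in [q] but not in [q0], so [q0] lengthens the chain by one step. *)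
apply: nI; apply: (chainS pq0 Iq0 q0q (Jq x Jx) _ hq).
apply: hx; rewrite mem_filter; apply/andP; split; first exact/asboolP.
by apply/flattenP; exists (qs I) => //; exact: map_f.
Qed.

End Chains.

(** * Finite length at a minimal prime of the support *)

Section FiniteLength.
Variables (R : comNzRingType) (M : lmodType R).
Hypotheses (nR : noeth_mod R^o) (nM : noeth_mod M).
Implicit Types (U V : set M) (p q : set R).

(* The localization of [M/U] at [p] has finite length if its support is [{p}];
   its submodules are the saturated submodules of [M] above [U]. *)
Lemma finite_length p U : is_prime p -> subm U ->
    (forall q, is_prime q -> ann U `<=` q -> q `<=` p -> p `<=` q) ->
  exists n, forall W : nat -> set M,
    (forall i, [/\ subm (W i), sat p (W i) `<=` W i & U `<=` W i]) ->
    (forall i, W i `<=` W i.+1) -> exists2 i, (i <= n)%N & W i.+1 `<=` W i.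
Proof.
(* [bdd V] bounds the chains between [U] and [V] at [p]. A maximal such [V] is everything at [p]:
   otherwise M/V has an associated prime inside [p], by hypothesis equal to [p], and adjoining the
   element [z'] that it annihilates keeps the lengths bounded. *)
move=> pp sU Up; pose bdd V := U `<=` V /\ exists n, forall W : nat -> set M,
    (forall i, [/\ subm (W i), sat p (W i) `<=` W i & U `<=` W i]) ->
    (forall i, W i `<=` sat p V) ->
    (forall i, W i `<=` W i.+1) -> exists2 i, (i <= n)%N & W i.+1 `<=` W i.
have [|V [sV [UV [n nP]] maxV]] := nM (F := bdd).
  exists U => //; split=> //; exists 0%N => W hW WU _; exists 0%N => //.
  have [_ W0 UW0] := hW 0%N.
  exact: subset_trans (subset_trans (WU 1%N) (sat_sub UW0)) W0.
have [hV|/existsNP[z nz]] := EM (forall z, sat p V z).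
  by exists n => W hW; apply: nP => // i z _; exact: hV.
have [b [pq qp Vq]] := exists_assoc_sat nR pp sV nz.
set z' := b *: z in pq qp Vq.
have pq' : p `<=` transporter (sat p V) z'.
  apply: Up => //; exact: subset_trans (ann_sub UV) Vq.
have nz' : ~ sat p V z'.
  by move=> h; apply: (prime1 pq); rewrite /transporter /= scale1r.
case: nz'; apply: sub_sat => //; apply: (maxV (adjoin V z')).
- exact: subm_adjoin.
- split; first exact: subset_trans UV (@sub_adjoin _ _ _ _).
  (* At [p], [adjoin V z'] over [V] is simple. If [W n.+1] is still inside [V], the bound for [V]
     applies to [W] frozen from index [n.+1] on. Otherwise the terms from [n.+1] on fill the simple
     quotient, and only their intersections with [V] can grow, which fails within [n] more steps. *)
  exists (n + n.+1)%N => W hW WV' Wmono.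
  have W_le i j : (i <= j)%N -> W i `<=` W j.
    move=> /subnK <-; elim: (j - i)%N => [|k IH] //.
    exact: subset_trans IH (Wmono _).
  have [W_V|nWV] := EM (W n.+1 `<=` sat p V).
    have [|||i lein Wi] := nP (fun i => W (minn i n.+1)).
    + by move=> i.
    + by move=> i; apply: subset_trans W_V; apply: W_le; exact: geq_minr.
    + by move=> i; apply: W_le; rewrite leq_min geq_minr geq_min leqnSn.
    exists i; first exact: leq_trans lein (leq_addr _ _).
    by move: Wi; rewrite !(minn_idPl _) // ?ltnS // ltnW.
  have [w [Ww nVw]] := nonsubset nWV.
  have [||| i lein Wi] := nP (fun i => W (i + n.+1)%N `&` sat p V).
  + move=> i; have [sW pW UW] := hW (i + n.+1)%N; split.
    * split; first by split; [exact: sW.1 | exact: (subm_sat pp sV).1].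
      move=> a x y [Wx Vx] [Wy Vy].
      by split; [exact: sW.2 | exact: (subm_sat pp sV).2].
    * move=> x [s ns [Wx Vx]]; split; last exact: sat_cancel Vx.
      by apply: pW; exists s.
    * by move=> x Ux; split; [exact: UW | exact/sub_sat/UV].
  + by move=> i x [].
  + by move=> i x [Wx Vx]; split=> //; exact: Wmono.
  exists (i + n.+1)%N; first by rewrite leq_add2r.
  move: Wi; rewrite addSn; set j := (i + n.+1)%N => Wi y Wy.
  have [sWj pWj UWj] := hW j.+1.
  have [t nt [c Vw]] := WV' _ _ Ww.
  have nc : ~ p c.
    move=> pc; apply: nVw; apply: (sat_cancel pp nt).
    rewrite -[t *: w](subrK (c *: z')).
    by apply: (submD (subm_sat pp sV)); [exact: sub_sat | exact: pq'].
  have [s ns [a Vy]] := WV' _ _ Wy.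
  have Ww' : W j w by apply: W_le Ww; exact: leq_addl.
  have [|Wcy _] := Wi ((c * s) *: y - (a * t) *: w).
    split; first by apply: submB => //; apply: submZ => //; exact: Wmono.
    apply: sub_sat => //.
    have -> : (c * s) *: y - (a * t) *: w =
      c *: (s *: y - a *: z') - a *: (t *: w - c *: z') by module.
    by apply: submB => //; apply: submZ.
  have [sW pW _] := hW j; apply: pW; exists (c * s); first exact: primeNM.
  by rewrite -[_ *: y](subrK ((a * t) *: w)); apply: submD => //; apply: submZ.
- exact: sub_adjoin.
- exact: mem_adjoin.
Qed.

End FiniteLength.

(** * Krull's principal ideal and height theorems *)

Section Krull.
Variable R : comNzRingType.
Hypothesis nR : noeth_mod R^o.
Implicit Types (I J p q : set R).

(* Krull's principal ideal theorem.  Otherwise [q2] would be minimal over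
   [q0 + (x)], and the images of the localizations at [q1] of the ideals
   [q0 + (c ^+ n)] in R/(q0 + (x)) would stabilize, for [c] in [q1] but not in
   [q0]. *)
Lemma principal_ideal_theorem q0 q1 q2 (x : R) :
    is_prime q0 -> is_prime q1 -> is_prime q2 ->
    q0 `<=` q1 -> ~ q1 `<=` q0 -> q1 `<=` q2 -> ~ q2 `<=` q1 -> q2 x ->
  exists q, [/\ is_prime q, q0 `<=` q, q x, q `<=` q2 & ~ q2 `<=` q].
Proof.
move=> p0 p1 p2 q01 nq10 q12 nq21 q2x; apply: contrapT => noq.
have [c [q1c nq0c]] := nonsubset nq10.
have nq1x : ~ q1 x by move=> q1x; apply: noq; exists q1.
pose P n : set R^o := @adjoin R R^o q0 (c ^+ n).
have sP n : subm (P n) by exact/subm_adjoin/prime_subm.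
pose S n : set R^o := sat q1 (P n); have sS n : subm (S n) by exact: subm_sat.
pose T n : set R^o := sat q2 (@adjoin R R^o (S n) x).
have sT n : subm (T n) by apply: subm_sat => //; exact: subm_adjoin.
have S_anti n : S n.+1 `<=` S n.
  apply: sat_sub => //; apply: adjoin_min => //; first exact: sub_adjoin.
  by rewrite exprS; apply: (submZ (sP n)); apply: mem_adjoin; exact: prime_subm.
have T_anti n : T n.+1 `<=` T n.
  apply: sat_sub; apply: adjoin_min; first exact: subm_adjoin.
    exact: subset_trans (S_anti n) (@sub_adjoin _ _ _ _).
  exact: mem_adjoin.
have q0S n : q0 `<=` S n by move=> a q0a; exact/sub_sat/sub_adjoin.
have q0T n : @adjoin R R^o q0 x `<=` T n.
  apply: adjoin_min => //; first by move=> a q0a; exact/sub_sat/sub_adjoin/q0S.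
  exact/sub_sat/mem_adjoin.
have sq0 : @subm R R^o q0 by exact: prime_subm.
have [|N hN] := finite_length nR nR p2 (@subm_adjoin R R^o _ x sq0).
  move=> q pq hq qq2; apply: contrapT => nq2; apply: noq; exists q; split=> //.
    move=> a q0a; apply: hq => b; apply: sub_adjoin.
    by rewrite -[_ *: _]/(a * (b : R)) mulrC; exact: (submZ sq0).
  apply: hq => b; rewrite -[_ *: _]/(x * (b : R)) mulrC.
  by apply: submZ; [exact: subm_adjoin | exact: mem_adjoin].
(* [finite_length] speaks of ascending sequences, so the descending [T] is read backwards from
   [N.+1]. *)
have [||i leiN Ti] := hN (fun i => T (N.+1 - i)%N).
- by move=> i; split=> //; exact: sat_sat.
- by move=> i; rewrite subnS; case: (N.+1 - i)%N.
move: Ti; rewrite subSS subSn //; set n := (N - i)%N => Tn.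
(* This inclusion is absurd: applied to c^n it gives c^n (t s - r c) in [q0], but c is not in [q0],
   and t s - r c is not even in [q1], which contains c but not t s. *)
suff : S n `<=` sat q2 (S n.+1).
  move=> /(_ (c ^+ n))[|s ns Ss].
    by apply: sub_sat => //; exact: mem_adjoin.
  have [t nt [r q0r]] := Ss.
  suff : q0 (c ^+ n * (t * s - r * c)).
    case: (p0) => _ _ q0M /q0M[|/q01 q1ts].
      elim: (n) => [|k IH]; first exact: prime1 p0.
      by rewrite exprS => /q0M[].
    have : ~ q1 (t * s) by apply: (primeNM p1) => // /q12.
    by apply; rewrite -[t * s](subrK (r * c)); apply: primeD => //; exact: primeMl.
  move: q0r; congr (q0 _); rewrite /GRing.scale /= exprS; ring.
(* Modulo [S n.+1], s a = r x for some r. Then x r is in [S n], which is saturated at [q1], and [x]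
   is outside [q1], so r itself is in [S n], as Nakayama requires. *)
apply: (@nakayama _ _ q2 (S n.+1) (S n) x) => // a Sa.
have [s ns [r Sr]] := Tn a (sub_sat p2 (@sub_adjoin _ _ _ _ _ Sa)).
exists s => //; exists r; last first.
  by apply: sub_sat => //; move: Sr; congr (S n.+1 _); rewrite /GRing.scale /=; ring.
apply: (sat_cancel p1 nq1x).
have -> : x *: (r : R^o) = s *: (a : R^o) - (s *: a - r *: (x : R^o)).
  by rewrite /GRing.scale /=; ring.
by apply: (submB (sS n)); [exact: (submZ (sS n)) | exact: S_anti].
Qed.

(** The principal ideal theorem pushes [x] down to the bottom prime at the cost of one step. [J]
    need not be I + (x): only the primes above it matter, which suits the annihilator of M/x M,
    known here only up to radical. *)
Lemma chain_principal p I J (x : R) n : is_prime p -> p x ->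
    (forall q, is_prime q -> q `<=` p -> I `<=` q -> q x -> J `<=` q) ->
  chain p I n.+1 -> chain p J n.
Proof.
move=> pp px; elim: n I J => [|n IH] I J IJ h.
  by apply: chain0; apply: IJ => //; exact: chain_top h.
move En: n.+2 h => k h; case: h En IJ => // {}I q0 K c m p0 Iq0 q0K Kc nc h [En] IJ.
move: h; rewrite -{m}En => /(chain_head pp)[q1 [p1 Kq1 q1p h]].
have [q1x|nq1x] := EM (q1 x).
  apply: chain_sub h; apply: IJ => //.
  exact: subset_trans Iq0 (subset_trans q0K Kq1).
have /(chain_head pp)[q2 [p2 q12 q2p {}h]] : chain p (@adjoin R R^o q1 x) n.
  apply: IH h => q pq _ q1q qx; exact: (@adjoin_min R R^o q1 q x (prime_subm pq)).
have q2x : q2 x by apply: q12; exact: (@mem_adjoin R R^o q1 x (prime_subm p1)).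
have q12' : q1 `<=` q2 by exact: subset_trans (@sub_adjoin R R^o q1 x) q12.
have [|||q [pq q0q qx qq2 nq]] := principal_ideal_theorem p0 p1 p2 _ _ q12' _ q2x.
- exact: subset_trans q0K Kq1.
- by move=> /(_ c (Kq1 _ Kc)).
- by move=> /(_ x q2x).
have [c' [q2c' nqc']] := nonsubset nq.
apply: (chainS pq _ qq2 q2c' nqc' h); apply: IJ => //.
  exact: subset_trans qq2 q2p.
exact: subset_trans Iq0 q0q.
Qed.

Lemma chain_irrefl p n : is_prime p -> ~ chain p p n.+1.
Proof.
move=> pp; suff gen I k : chain p I k -> p `<=` I -> k = 0%N.
  by move=> /gen/(_ (@subset_refl _ p)).
case=> {I k} // I q J c k _ Iq _ Jc nc h pI.
by case: nc; apply/Iq/pI; exact: chain_top h _ Jc.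
Qed.

(** Each generator of [p] costs a chain at most one step, and above [p] itself no step is left, so
    the number of generators is a bound. *)
Lemma chain_bounded p I : is_prime p -> exists n, ~ chain p I n.+1.
Proof.
move=> pp; have [l pl] := noeth_lspan nR (prime_subm pp).
exists (size l) => /(chain_head pp)[q [pq _ _ h]].
apply: (@chain_irrefl p 0 pp); rewrite {2}pl.
have : {in l, forall x, p x} by move=> x /mem_lspan; rewrite -pl.
move: h; rewrite -addn1; elim: (l) (1%N) => [|x l' IH] n h lp.
  by apply: (@chain_sub _ p _ q n _ h) => _ ->; exact: prime0 pq.
apply: (@chain_principal p (lspan l') _ x) => //; first by apply: lp; exact: mem_head.
  by move=> r pr _ lr rx; exact: (@adjoin_min R R^o _ r x (prime_subm pr)).
by apply: IH => [|y yl']; rewrite ?addnS //; apply: lp; rewrite in_cons yl' orbT.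
Qed.

Lemma chain_max p I : is_prime p -> I `<=` p ->
  exists2 n, chain p I n & ~ chain p I n.+1.
Proof.
move=> pp Ip; have [N] := chain_bounded I pp.
elim: N => [|N IH] h; first by exists 0%N => //; exact: chain0.
by have [|/IH] := EM (chain p I N.+1); first by exists N.+1.
Qed.

End Krull.

(** * Cohen-Macaulay modules *)

Section CohenMacaulay.
Variables (R : comNzRingType) (M : lmodType R).
Hypotheses (nR : noeth_mod R^o) (nM : noeth_mod M).
Implicit Types (U V : set M) (p q m : set R) (x y : R) (z : M) (xs : seq R).

Definition reg p U x := forall z, sat p U (x *: z) -> sat p U z.

(* The localization of [M/U] at [p] has a regular sequence of length [r] in [p]. *)
Fixpoint has_reg_seq p U r : Prop :=
  if r is r'.+1 then
    exists x, [/\ p x, reg p U x & has_reg_seq p (addmul U x) r']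
  else exists z, ~ sat p U z.

Lemma reg_antitone p q U x : is_prime p -> is_prime q -> q `<=` p ->
  reg p U x -> reg q U x.
Proof.
move=> pp pq qp hx z [s ns Us]; apply: (sat_cancel pq ns).
apply: (sat_antitone qp); apply: hx; apply: (sub_sat pp).
by rewrite scalerA [x * s]mulrC -scalerA.
Qed.

(** Up to denominators: from y z = x v, regularity of x modulo y gives v = y w, and cancelling y
    gives z = x w. *)
Lemma reg_swap p U x y : is_prime p -> subm U ->
  reg p U y -> reg p (addmul U y) x -> reg p (addmul U x) y.
Proof.
move=> pp sU hy hx z [s ns [v Uv]].
have [t nt [w Uw]] : sat p (addmul U y) v.
  apply: hx; apply: (sub_sat pp); exists (s *: z).
  have -> : x *: v - y *: (s *: z) = -1 *: (s *: (y *: z) - x *: v) by module.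
  exact: submZ.
have [r nr Ur] : sat p U ((t * s) *: z - x *: w).
  apply: hy; apply: (sub_sat pp).
  have -> : y *: ((t * s) *: z - x *: w) =
    t *: (s *: (y *: z) - x *: v) + x *: (t *: v - y *: w) by module.
  by apply: submD => //; apply: submZ.
exists (r * (t * s)); first by do !apply: primeNM => //.
exists (r *: w).
suff -> : (r * (t * s)) *: z - x *: (r *: w) =
  r *: ((t * s) *: z - x *: w) by [].
by module.
Qed.

Lemma has_reg_seq_supp p U r : has_reg_seq p U r -> exists z, ~ sat p U z.
Proof.
elim: r U => //= r IH U [x [_ _ /IH[z nz]]]; exists z => hz; apply: nz.
exact: sat_sub (@sub_addmul _ _ U x) _ hz.
Qed.

(* If [Q] is associated to [M/U] and [y] is regular then some element killed by
   [Q] survives in [M/(U + y M)], so [Q] is strictly contained in an associated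
   prime of this module. *)
Lemma has_reg_seq_assoc p U z r : is_prime p -> subm U -> has_reg_seq p U r ->
  is_prime (transporter (sat p U) z) -> chain p (transporter (sat p U) z) r.
Proof.
move=> pp; elim: r U z => [|r IH] U z sU hr pQ.
  apply: chain0; apply: transporter_sat_sub => // h.
  by apply: (prime1 pQ); rewrite /transporter /= scale1r.
case: hr => y [py hy hr]; set Q := transporter _ z in pQ *.
pose H := [set w | forall a, Q a -> sat p U (a *: w)].
have sS := subm_sat pp sU.
have sH : subm H.
  split=> [a _|c v w Hv Hw a Qa]; first by rewrite scaler0; exact: sS.1.
  have -> : a *: (c *: v + w) = c *: (a *: v) + a *: w by module.
  by apply: sS.2; [exact: Hv | exact: Hw].
have [w [Hw nw]] : exists w, H w /\ ~ sat p (addmul U y) w.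
  apply: contrapT => h; apply: (prime1 pQ); rewrite /Q /transporter /= scale1r.
  have Hz : H z by [].
  (* If [H] were contained in U + y M at [p], the cofactor of the regular element [y] would again be
     killed by [Q], so [H] would lie in U + y H and Nakayama would make [z] vanish. *)
  apply: (@nakayama _ _ p U H y) Hz => // w Hw.
  have [s ns [u Uu]] : sat p (addmul U y) w.
    by apply: contrapT => nw; apply: h; exists w.
  exists s => //; exists u; last exact: sub_sat.
  move=> a Qa; apply: hy.
  have -> : y *: (a *: u) = (a * s) *: w - a *: (s *: w - y *: u) by module.
  apply: (submB sS); last by apply: sub_sat => //; exact: submZ.
  by rewrite mulrC -scalerA; apply: (submZ sS); exact: Hw.
have [b [pQ' Q'p _]] := exists_assoc_sat nR pp (subm_addmul y sU) nw.
set Q' := transporter _ _ in pQ' Q'p.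
apply: (chainS pQ (@subset_refl _ _) _ _ _ (IH _ _ (subm_addmul y sU) hr pQ')).
- move=> a Qa; rewrite /transporter /= scalerA mulrC -scalerA.
  apply: submZ; first exact/subm_sat/subm_addmul.
  by apply: (sat_sub (@sub_addmul _ _ U y)); exact: Hw.
- by rewrite /transporter /=; apply: sub_sat => //; exact: mul_addmul.
- by move=> /hy hz; apply: (prime1 pQ); rewrite /Q /transporter /= scale1r.
Qed.

Lemma has_reg_seq_chain p U r : is_prime p -> subm U -> has_reg_seq p U r ->
  chain p (ann U) r.
Proof.
move=> pp sU hr; have [z nz] := has_reg_seq_supp hr.
have [b [pQ _ UQ]] := exists_assoc_sat nR pp sU nz.
exact: chain_sub UQ (has_reg_seq_assoc pp sU hr pQ).
Qed.

(** An associated prime of M/U inside the head [q] of the chain misses [x], which stays regular at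
    [q]; it therefore adds a step below [q]. *)
Lemma chain_reg p U x n : is_prime p -> subm U -> reg p U x ->
  chain p (ann (addmul U x)) n -> chain p (ann U) n.+1.
Proof.
move=> pp sU hx /(chain_head pp)[q [pq /(ann_addmul_sub _ nM pq sU)[Uq qx] qp h]].
have [z nz] := (supp_ann nM pq sU).2 Uq.
have [b [pQ Qq UQ]] := exists_assoc_sat nR pq sU nz.
apply: (chainS pQ UQ Qq qx _ h) => /(reg_antitone pp pq qp hx) h1.
by apply: (prime1 pQ); rewrite /transporter /= scale1r.
Qed.

Lemma chain_addmul p U x n : is_prime p -> subm U -> p x ->
  chain p (ann U) n.+1 -> chain p (ann (addmul U x)) n.
Proof.
move=> pp sU px; apply: (chain_principal nR pp px) => q pq _ Uq qx.
exact/(ann_addmul_sub _ nM pq sU).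
Qed.

Lemma chain_mulseq p U xs n : is_prime p -> subm U -> {in xs, forall x, p x} ->
  chain p (ann U) (size xs + n) -> chain p (ann (mulseq U xs)) n.
Proof.
move=> pp; elim: xs U => //= x xs IH U sU xsp h; apply: IH.
- exact: subm_addmul.
- by move=> y yxs; apply: xsp; rewrite in_cons yxs orbT.
- by apply: chain_addmul => //; apply: xsp; exact: mem_head.
Qed.

(** Every associated prime of M/U at [p] starts a chain of length r+1. If one contained [x], that
    chain would survive in the support of M/(U + x M). *)
Lemma reg_of_dim p U x r : is_prime p -> subm U -> has_reg_seq p U r.+1 -> p x ->
  ~ chain p (ann (addmul U x)) r.+1 -> reg p U x.
Proof.
move=> pp sU hr px nx z Uxz; apply: contrapT => nz; apply: nx.
have [b [pQ Qp UQ]] := exists_assoc_sat nR pp sU nz.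
apply: chain_sub (has_reg_seq_assoc pp sU hr pQ).
apply/(ann_addmul_sub _ nM pQ sU); split=> //.
rewrite /transporter /= scalerA mulrC -scalerA; apply: submZ => //.
exact: subm_sat.
Qed.

(* Exchange: [w] drops the dimension of [M/U], [M/(U + x M)] and [M/(U + y M)]
   for the head [y] of a regular sequence, so [y] can be replaced first by [w]
   and then by [x]. *)
Lemma cohen_macaulay_step p U x r : is_prime p -> subm U ->
    has_reg_seq p U r.+1 -> ~ chain p (ann U) r.+2 -> p x ->
    ~ chain p (ann (addmul U x)) r.+1 ->
  reg p U x /\ has_reg_seq p (addmul U x) r.
Proof.
move=> pp; elim: r U x => [|r IH] U x sU hr dimU px dimx.
  split; first exact: reg_of_dim hr px dimx.
  have [z nz] := has_reg_seq_supp hr.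
  apply/(supp_ann nM pp (subm_addmul x sU)).
  by apply/(ann_addmul_sub _ nM pp sU); split=> //; apply/(supp_ann nM pp sU); exists z.
have rx := reg_of_dim pp sU hr px dimx; split=> //.
case: (hr) => y [py ry hy].
have sUx := subm_addmul x sU; have sUy := subm_addmul y sU.
have dimy : ~ chain p (ann (addmul U y)) r.+2 by move=> /(chain_reg pp sU ry).
have [|w pw hw] := exists_drop (m := p) (p := p)
    (Is := [:: ann U; ann (addmul U x); ann (addmul U y)]) nR pp pp.
  by move=> J; rewrite !inE => /or3P[] /eqP->; exact: subm_ann.
(* Here [m] and [p] coincide, so the bound on chains above [p] is e = 0. *)
have drop V k : ann V \in [:: ann U; ann (addmul U x); ann (addmul U y)] ->
    subm V -> ~ chain p (ann V) k.+2 -> ~ chain p (ann (addmul V w)) k.+1.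
  move=> VIs sV; apply: (hw _ VIs _ k 0%N) => //.
  - by apply: ann_sub; exact: sub_addmul.
  - exact: ann_addmul.
  - exact: chain_irrefl.
have dimw : ~ chain p (ann (addmul U w)) r.+2 by apply: drop; rewrite ?mem_head.
have dimxw : ~ chain p (ann (addmul (addmul U x) w)) r.+1.
  by apply: drop => //; rewrite !inE eqxx orbT.
have dimyw : ~ chain p (ann (addmul (addmul U y) w)) r.+1.
  by apply: drop => //; rewrite !inE eqxx !orbT.
have rw : reg p U w by exact: reg_of_dim hr pw dimw.
have sUw := subm_addmul w sU.
have [ryw hyw] := IH _ _ sUy hy dimy pw dimyw.
have hw' : has_reg_seq p (addmul U w) r.+1.
  by exists y; split=> //; [exact: reg_swap | rewrite addmulAC].
have [rwx hwx] : reg p (addmul U w) x /\ has_reg_seq p (addmul (addmul U w) x) r.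
  by apply: IH => //; rewrite addmulAC.
by exists w; split=> //; [exact: reg_swap | rewrite addmulAC].
Qed.

(** No element lowers the dimension by more than one, so a total drop by [size xs] forces a drop at
    every step, and [cohen_macaulay_step] can be iterated. *)
Lemma cohen_macaulay_reg p U xs r : is_prime p -> subm U ->
    has_reg_seq p U r -> ~ chain p (ann U) r.+1 -> {in xs, forall x, p x} ->
    (size xs <= r)%N -> ~ chain p (ann (mulseq U xs)) (r - size xs).+1 ->
  forall i, (i < size xs)%N -> reg p (mulseq U (take i xs)) xs`_i.
Proof.
move=> pp; elim: xs U r => // x xs IH U [|r] //= sU hr dimU xsp szr dimxs.
have px : p x by apply: xsp; exact: mem_head.
have xsp' : {in xs, forall x, p x}.
  by move=> y yxs; apply: xsp; rewrite in_cons yxs orbT.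
have sUx := subm_addmul x sU.
have dimx : ~ chain p (ann (addmul U x)) r.+1.
  move=> h; apply: dimxs; rewrite subSS; apply: chain_mulseq => //.
  by rewrite addnS subnKC.
have [rx hx] := cohen_macaulay_step pp sU hr dimU px dimx.
by case=> [_|i] //= szi; apply: (IH _ r).
Qed.

Lemma reg_has_reg_seq p U xs : is_prime p -> subm U -> ann U `<=` p ->
    {in xs, forall x, p x} ->
    (forall i, (i < size xs)%N -> reg p (mulseq U (take i xs)) xs`_i) ->
  has_reg_seq p U (size xs).
Proof.
move=> pp; elim: xs U => [|x xs IH] U sU Up xsp hxs.
  exact/(supp_ann nM pp sU).
have px : p x by apply: xsp; exact: mem_head.
exists x; split=> //; first exact: (hxs 0%N).
apply: IH => [|||i szi]; first exact: subm_addmul.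
- exact/(ann_addmul_sub _ nM pp sU).
- by move=> y yxs; apply: xsp; rewrite in_cons yxs orbT.
- exact: (hxs i.+1).
Qed.

(* The sequence is padded when the dimension drops too fast. *)
Lemma exists_seq m p U k e : is_prime m -> is_prime p -> subm U ->
    ~ chain m p e.+1 -> ~ chain m (ann U) (k + e).+1 ->
  exists xs, [/\ size xs = k, {in xs, forall x, p x} &
    ~ chain m (ann (mulseq U xs)) e.+1].
Proof.
move=> pm pp sU dimp; elim: k U sU => [|k IH] U sU dimU; first by exists [::].
have [|x px hx] := exists_drop (m := m) (p := p) (Is := [:: ann U]) nR pm pp.
  by move=> J; rewrite inE => /eqP->; exact: subm_ann.
have [||xs [sz xsp dimxs]] := IH (addmul U x); first exact: subm_addmul.
  apply: (hx (ann U) _ _ _ e) => //; rewrite ?mem_head ?leq_addl //.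
    by apply: ann_sub; exact: sub_addmul.
  exact: ann_addmul.
exists (x :: xs); split=> //=; first by rewrite sz.
by move=> y; rewrite in_cons => /orP[/eqP->//|]; exact: xsp.
Qed.

(** Some r - e elements of [p] cut the dimension at [m] down to e = dim R/p. They are regular at
    [m], hence at [p]. A chain up to [p] with more than r - e steps would, continued to [m], exceed
    the dimension r. *)
Lemma cohen_macaulay_localize m p U r e : is_prime m -> is_prime p -> subm U ->
    has_reg_seq m U r -> ~ chain m (ann U) r.+1 -> ann U `<=` p ->
    chain m p e -> ~ chain m p e.+1 ->
  [/\ (e <= r)%N, has_reg_seq p U (r - e) & ~ chain p (ann U) (r - e).+1].
Proof.
move=> pm pp sU hr dimU Up he dimp.
have er : (e <= r)%N.
  rewrite leqNgt; apply/negP => re; apply: dimU.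
  exact: chain_leq re (chain_sub Up he).
have pm' := chain_top he.
split=> //; last first.
  move=> h; apply: dimU; apply: chain_leq (chain_cat h he).
  by rewrite addSn subnK.
have [|xs [sz xsp dimxs]] := @exists_seq m p U (r - e) e pm pp sU dimp.
  by rewrite subnK.
rewrite -sz; apply: reg_has_reg_seq => // i szi.
apply: (reg_antitone pm pp pm'); apply: (cohen_macaulay_reg pm sU hr) => //.
- by move=> x /xsp/pm'.
- by rewrite sz leq_subr.
- by rewrite sz subKn.
Qed.

(** Going through [p], the depth at [q] is at least r - ep - c, where ep = dim R/p and c is the
    height of [p] over [q]. Going directly, the dimension at [q] is at most r - eq with eq = dim
    R/q. Hence eq <= ep + c. *)
Lemma cohen_macaulay_catenary m p q U r k e : is_prime m -> is_prime p ->
    is_prime q -> subm U -> has_reg_seq m U r -> ~ chain m (ann U) r.+1 ->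
    ann U `<=` q -> q `<=` p -> p `<=` m ->
    chain m q (k + e) -> ~ chain m p e.+1 -> chain p q k.
Proof.
move=> pm pp pq sU hr dimU Uq qp p_m hq dimp.
have Up := subset_trans Uq qp.
have [ep hp dimp'] := chain_max nR pm p_m.
have [eq hq' dimq] := chain_max nR pm (subset_trans qp p_m).
have [c hc dimc] := chain_max nR pp qp.
have [epr hrp dimUp] := cohen_macaulay_localize pm pp sU hr dimU Up hp dimp'.
have [cr hrq _] := cohen_macaulay_localize pp pq sU hrp dimUp Uq hc dimc.
have [eqr _ dimUq] := cohen_macaulay_localize pm pq sU hr dimU Uq hq' dimq.
have le1 : (r - ep - c <= r - eq)%N.
  rewrite leqNgt; apply/negP => lt; apply: dimUq.
  exact: chain_leq lt (has_reg_seq_chain pq sU hrq).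
have le2 : (ep <= e)%N.
  by rewrite leqNgt; apply/negP => lt; apply: dimp; exact: chain_leq lt hp.
have le3 : (k + e <= eq)%N.
  by rewrite leqNgt; apply/negP => lt; apply: dimq; exact: chain_leq lt hq.
apply: chain_leq hc; move: le1 le2 le3 epr cr eqr; clear; lia.
Qed.

End CohenMacaulay.

(** * Lengths of chains of prime ideals *)

Section Suprema.
Implicit Types (P : nat -> Prop) (n : nat).

Lemma nat_sup_max P n : P n -> (forall k, P k -> (k <= n)%N) ->
  nat_sup P = n%:E%E.
Proof.
move=> Pn Pmax; rewrite /nat_sup asboolT; last by exists n.
apply: xget_unique; first by exists n.
by move=> _ [k [Pk kmax] ->]; congr EFin; apply/eqP; rewrite eqn_leq kmax // Pmax.
Qed.

Lemma nat_sup_fin P n : nat_sup P = n%:E%E -> P n /\ ~ P n.+1.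
Proof.
rewrite /nat_sup; case: asboolP => // _; case: xgetP => [_ -> [k [Pk kmax] ->] [<-]|//].
by split=> // /kmax; rewrite ltnn.
Qed.

Lemma nat_sup_neq_pinfty P : P 0%N ->
  (nat_sup P <> +oo%E) <-> exists n, forall k, P k -> (k <= n)%N.
Proof.
move=> P0; split=> [|[n Pn]].
  rewrite /nat_sup asboolT; last by exists 0%N.
  by case: xgetP => [_ _ [n [_ nmax] _] _|//]; exists n.
have ex : exists k, `[< P k >] by exists 0%N; apply/asboolP.
have [k /asboolP Pk kmax] := ex_maxnP ex (fun k Pk => Pn k (asboolW Pk)).
by rewrite (nat_sup_max Pk) // => j Pj; apply/kmax/asboolP.
Qed.

End Suprema.

Section PrimeIdealSets.
Variable R : comNzRingType.

Fact mk_idealr_subproof (I : set R) : @subm R R^o I -> ~ I 1 ->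
  idealr_closed (fun a => `[< I a >]).
Proof.
move=> sI nI; split; first by apply/asboolP; exact: sI.1.
  by apply/negP => /asboolP.
move=> a b c /asboolP Ib /asboolP Ic; apply/asboolP; exact: sI.2.
Qed.

Definition mk_idealr (I : set R) (sI : @subm R R^o I) (nI : ~ I 1) : idealr R :=
  HB.pack_for (idealr R) (fun a => `[< I a >])
    (isIdealr.Build R _ (mk_idealr_subproof sI nI)).

Fact mk_prime_subproof (q : set R) : is_prime q ->
  prime_idealr_closed (fun a => `[< q a >]).
Proof.
move=> [_ _ qM] a b /asboolP /qM h; apply/orP.
by case: h => h; [left | right]; apply/asboolP.
Qed.

Definition mk_prime (q : set R) (pq : is_prime q) : prime_idealr R :=
  HB.pack_for (prime_idealr R) (fun a => `[< q a >])
    (isIdealr.Build R _ (mk_idealr_subproof (prime_subm pq) (prime1 pq)))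
    (isPrimeIdealrClosed.Build R _ (mk_prime_subproof pq)).

Definition ideal_set (I : idealr R) : set R := [set a | a \in I].

Lemma ideal_set_mk (I : set R) (sI : @subm R R^o I) (nI : ~ I 1) :
  ideal_set (mk_idealr sI nI) = I.
Proof. by rewrite predeqE => a; split=> /asboolP. Qed.

Lemma prime_set_mk (q : set R) (pq : is_prime q) : ideal_set (mk_prime pq) = q.
Proof. by rewrite predeqE => a; split=> /asboolP. Qed.

Lemma subm_ideal_set (I : idealr R) : @subm R R^o (ideal_set I).
Proof.
split=> [|a b c Ib Ic]; first exact: rpred0.
by apply: rpredD => //; exact: idealMr.
Qed.

Lemma is_prime_set (p : prime_idealr R) : is_prime (ideal_set p).
Proof.
split; first exact: subm_ideal_set.
  by rewrite /ideal_set /= idealr1.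
by move=> a b; rewrite /ideal_set /= prime_idealrM => /orP.
Qed.

Lemma mk_prime_sub (q : set R) (pq : is_prime q) (I : idealr R) :
  {subset mk_prime pq <= I} <-> q `<=` ideal_set I.
Proof. by split=> [qI a qa|qI a /asboolP/qI//]; apply: qI; exact/asboolP. Qed.

Lemma sub_mk_prime (q : set R) (pq : is_prime q) (I : idealr R) :
  {subset I <= mk_prime pq} <-> ideal_set I `<=` q.
Proof. by split=> [Iq a /Iq/asboolP//|Iq a /Iq qa]; exact/asboolP. Qed.

End PrimeIdealSets.

Section ChainSup.
Variables (R A : comNzRingType).

Lemma chain_seqP (p I : set R) n : is_prime p -> chain p I n <->
  exists t : nat -> set R, [/\ I `<=` t 0%N,
    forall i, (i <= n)%N -> is_prime (t i) /\ t i `<=` p &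
    forall i, (i < n)%N -> t i `<=` t i.+1 /\ ~ t i.+1 `<=` t i].
Proof.
move=> pp; split.
  elim=> {I n} [I Ip|I q J c n pq Iq qJ Jc nc h [t [Jt tp tlt]]].
    by exists (fun=> p); split=> // i _; split=> //; exact: subset_refl.
  exists (fun i => if i is j.+1 then t j else q); split=> // [[_|i]|[_|i]] //.
  - split=> //; exact: subset_trans qJ (chain_top h).
  - exact: tp.
  - by split; [exact: subset_trans qJ Jt | move=> /(_ c (Jt c Jc))].
  - exact: tlt.
elim: n I => [|n IH] I [t [It tp tlt]].
  by apply: chain0; apply: subset_trans It _; exact: (tp 0%N _).2.
have [t01 nt01] := tlt 0%N isT; have [c [t1c nt0c]] := nonsubset nt01.
apply: (chainS (tp 0%N _).1 It t01 t1c nt0c) => //; apply: IH.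
exists (fun i => t i.+1); split=> [|i lin|i lin].
- exact: subset_refl.
- exact: tp.
- exact: tlt.
Qed.

(** Covers two cases: [A] is [R] itself, or [A] is its localization at [p] and [F] is
    contraction. *)
Lemma chain_supE (p I : set R) (X : prime_idealr A -> Prop)
    (F : prime_idealr A -> set R) : is_prime p ->
    (forall P, X P -> [/\ is_prime (F P), I `<=` F P & F P `<=` p]) ->
    (forall P Q, F P `<=` F Q <-> {subset P <= Q}) ->
    (forall q, is_prime q -> I `<=` q -> q `<=` p -> exists2 P, X P & F P = q) ->
  chain_sup (@prime_lt A) X = nat_sup (chain p I).
Proof.
move=> pp XF FE Fex; rewrite /chain_sup; congr nat_sup; rewrite predeqE => n.
rewrite chain_seqP //; split=> [[t [tX tlt]]|[t [It tp tlt]]].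
  exists (F \o t); split=> [|i lin|i lin] /=.
  - by have [] := XF _ (tX 0%N isT).
  - by have [] := XF _ (tX i lin).
  - by have [lt1 lt2] := tlt i lin; split; [apply/FE | move/FE].
have It' i : (i <= n)%N -> I `<=` t i.
  elim: i => [|i IH] // lin.
  exact: subset_trans (IH (ltnW lin)) (tlt i lin).1.
(* [P0] is the default value of the lifted sequence beyond index [n]. *)
have [P0 _ _] : exists2 P, X P & F P = t 0%N.
  by apply: Fex; [exact: (tp 0%N _).1 | | exact: (tp 0%N _).2].
have /choice[u uP] : forall i, exists P, (i <= n)%N -> X P /\ F P = t i.
  move=> i; case: (leqP i n) => lin; last by exists P0.
  have [P XP FP] : exists2 P, X P & F P = t i.
    by apply: Fex; [exact: (tp i lin).1 | exact: It' | exact: (tp i lin).2].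
  by exists P.
exists u; split=> [i /uP[]//|i lin].
have [_ E1] := uP i (ltnW lin); have [_ E2] := uP i.+1 lin.
by have [lt1 lt2] := tlt i lin; rewrite -E1 -E2 in lt1 lt2; split; [apply/FE | move/FE].
Qed.

End ChainSup.

(** * Quotients, supports and Serre classes *)

Section Linear.
Variable R : comNzRingType.
Implicit Types (L M N : lmodType R).

Definition mk_linear L N (f : L -> N) (lf : linear f) : {linear L -> N} :=
  HB.pack_for {linear L -> N} f (GRing.isLinear.Build R L N *:%R f lf).

Lemma noeth_embed M N (F : set N -> set M) :
    (forall W, subm W -> subm (F W)) ->
    (forall W W', W `<=` W' -> F W `<=` F W') ->
    (forall W W', F W `<=` F W' -> W `<=` W') ->
  noeth_mod M -> noeth_mod N.
Proof.
move=> sF F_mono F_le nM G [W0 sW0 GW0].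
have [|V [_ [W [sW GW] defV] maxW]] :=
    nM [set V | exists2 W, subm W /\ G W & V = F W].
  by exists (F W0); [exact: sF | exists W0].
exists W; split=> // W' sW' GW' /F_mono WW'; apply: F_le; rewrite -defV.
by apply: maxW; [exact: sF | exists W' | rewrite defV].
Qed.

Lemma subm_image (M N : lmodType R) (g : {linear M -> N}) (U : set M) :
  subm U -> subm (g @` U).
Proof.
move=> sU; split=> [|a _ _ [x Ux <-] [y Uy <-]].
  by exists 0; [exact: sU.1 | rewrite linear0].
by exists (a *: x + y); [exact: sU.2 | rewrite linearP].
Qed.

Section Quotient.
Variables (M : lmodType R) (U : submodClosed M).

Lemma quot_projZ a x : quot_proj U (a *: x) = a *: quot_proj U x.
Proof. by rewrite -quotmod_scaleE. Qed.

Fact quot_proj_linear : linear (quot_proj U).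
Proof. by move=> a x y; rewrite -quot_projD quot_projZ. Qed.
Definition quot_lin : {linear M -> quotmod U} := mk_linear quot_proj_linear.

Lemma quot_proj_eq0 x : quot_proj U x = 0 <-> x \in U.
Proof.
have -> : 0 = quot_proj U 0 by rewrite -[0 in RHS](scale0r 0) quot_projZ scale0r.
split=> [/eqP|Ux].
  by rewrite -Quotient.idealrBE subr0.
by apply/eqP; rewrite -Quotient.idealrBE subr0.
Qed.

Lemma quot_proj_inj x y : quot_proj U x = quot_proj U y <-> x - y \in U.
Proof.
rewrite -quot_proj_eq0 -[quot_proj U]/(quot_lin : M -> _) linearB.
by split=> [->|/eqP]; [rewrite subrr | rewrite subr_eq0 => /eqP].
Qed.

Lemma quot_lift N (f : {linear M -> N}) : (forall x, x \in U -> f x = 0) ->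
  exists g : {linear quotmod U -> N}, forall x, g (quot_proj U x) = f x.
Proof.
move=> fU; pose g (z : quotmod U) := f (repr z).
have gE x : g (quot_proj U x) = f x.
  apply/eqP; rewrite -subr_eq0 -linearB; apply/eqP/fU/quot_proj_inj.
  by rewrite /quot_proj reprK.
have lg : linear g.
  move=> a z w; elim/quot_projW: z => x; elim/quot_projW: w => y.
  by rewrite -quot_projZ quot_projD !gE linearP.
by exists (mk_linear lg).
Qed.

Lemma noeth_quot : noeth_mod M -> noeth_mod (quotmod U).
Proof.
apply: (@noeth_embed _ _ (fun W => [set x | W (quot_proj U x)]))
  => [W sW|W W' h x|W W' h].
- split=> [|a x y Wx Wy] /=; last by rewrite quot_proj_linear; exact: sW.2.
  by rewrite (quot_proj_eq0 0).2 ?rpred0 //; exact: sW.1.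
- exact: h.
- by elim/quot_projW; exact: h.
Qed.
End Quotient.

Lemma submod_lift L N (V : submodClosed N) (f : {linear L -> N}) :
  (forall x, f x \in V) -> exists g : {linear L -> submod V}, forall x, val (g x) = f x.
Proof.
move=> fV; pose g x : submod V := Sub (f x) (fV x).
have lg : linear g by move=> a x y; apply: val_inj; rewrite linearP /= linearP.
by exists (mk_linear lg).
Qed.

Lemma noeth_submod M (V : submodClosed M) : noeth_mod M -> noeth_mod (submod V).
Proof.
apply: (@noeth_embed _ _ (fun W => [set x | exists2 w, W w & val w = x])).
- move=> W sW; split=> [|a x y [v Wv <-] [w Ww <-]].
    by exists 0; [exact: sW.1 | rewrite linear0].
  by exists (a *: v + w); [exact: sW.2 | rewrite linearP].
- by move=> W W' h x [w /h W'w <-]; exists w.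
- move=> W W' h w Ww; have [|v W'v /val_inj <- //] := h (val w).
  by exists w.
Qed.

End Linear.

Section Support.
Variables (R : comNzRingType) (M : lmodType R) (p : prime_idealr R).

Lemma frac_eq0 (x : M) (s : denom p) :
  frac x s = 0 <-> exists2 u, u \notin p & u *: x = 0.
Proof.
split=> [/fracP[u]|[u nu ux]].
  by rewrite den1 scale1r !scaler0 => h; exists (den u) => //; exact: denP.
apply/fracP; exists (exist _ u nu : denom p).
by rewrite den1 scale1r !scaler0.
Qed.

Lemma suppP : supp M p <-> exists z : M, ~ sat (ideal_set p) [set 0] z.
Proof.
split=> [[z]|[z nz]]; last first.
  exists (frac z (denom1 p)) => /frac_eq0[u nu uz]; apply: nz; exists u => //.
  exact/negP.
elim/fracW: z => z s nz; exists z => -[u nu uz]; apply: nz; apply/frac_eq0.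
by exists u => //; exact/negP.
Qed.

End Support.

Lemma supp_subquot (R : comNzRingType) (M : lmodType R) (V U : submodClosed M)
    (p : prime_idealr R) :
  supp (subquot V U) p <->
  exists2 z, z \in V & ~ sat (ideal_set p) [set x | x \in U] z.
Proof.
rewrite suppP; split=> [[]|[z Vz nz]].
  elim/quot_projW=> z nz; exists (val z); first exact: valP.
  move=> [s ns Us]; apply: nz; exists s => //.
  by rewrite /= -quot_projZ; apply/quot_proj_eq0; rewrite unfold_in /restr_pred linearZ.
exists (quot_proj _ (Sub z Vz : submod V)) => -[s ns /=].
rewrite -quot_projZ => /quot_proj_eq0; rewrite unfold_in /restr_pred linearZ /= => Us.
by apply: nz; exists s.
Qed.

Lemma supp_quotmod (R : comNzRingType) (M : lmodType R) (U : submodClosed M)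
    (p : prime_idealr R) :
  supp (quotmod U) p <-> exists z, ~ sat (ideal_set p) [set x | x \in U] z.
Proof.
rewrite suppP; split=> [[]|[z nz]].
  elim/quot_projW=> z nz; exists z => -[s ns Us]; apply: nz; exists s => //.
  by rewrite /= -quot_projZ; apply/quot_proj_eq0.
exists (quot_proj U z) => -[s ns /=]; rewrite -quot_projZ => /quot_proj_eq0 Us.
by apply: nz; exists s.
Qed.

Lemma supp_cyclic (R : comNzRingType) (I : submodClosed R^o) (p : prime_idealr R) :
  supp (quotmod I) p <-> {subset I <= p}.
Proof.
rewrite supp_quotmod; split=> [[z nz] a Ia|Ip].
  apply/negPn/negP => na; apply: nz; exists a; first exact/negP.
  by rewrite /= -[a *: z]/(a * (z : R)) mulrC; exact: (@rpredZ R R^o I z).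
exists 1 => -[s ns /=]; rewrite -[s *: _]/(s * 1) mulr1 => /Ip; exact: ns.
Qed.

(** * Serre classes and supports *)

Section SerreClass.
Variables (R : comNzRingType) (S : lmodType R -> Prop).
Hypothesis S_serre : serre_class S.
Implicit Types L M N : lmodType R.

Lemma serre_ext M (U : submodClosed M) :
  S M <-> S (submod U) /\ S (quotmod U).
Proof.
apply: (S_serre.2 _ _ _ (val : {linear submod U -> M}) (quot_lin U)).
split; first exact: val_inj.
  by elim/quot_projW=> x; exists x.
move=> x; rewrite [quot_lin U x]/(quot_proj U x) quot_proj_eq0.
split=> [Ux|[y <-]]; last exact: valP.
by exists (Sub x Ux : submod U).
Qed.

Fact image_closed L N (f : {linear L -> N}) :
  submod_closed (fun y => `[< exists x, f x = y >]).
Proof.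
split=> [|a y z /asboolP[u <-] /asboolP[v <-]]; apply/asboolP.
  by exists 0; rewrite linear0.
by exists (a *: u + v); rewrite linearP.
Qed.

Lemma serre_sub L N (f : {linear L -> N}) : injective f -> S N -> S L.
Proof.
move=> f_inj SN.
pose V : submodClosed N :=
  HB.pack_for (submodClosed N) (fun y => `[< exists x, f x = y >])
  (GRing.isSubmodClosed.Build R N _ (image_closed f)).
suff [] : S L /\ S (quotmod V) by [].
apply/(S_serre.2 _ N _ f (quot_lin V)) => //; split=> //.
  by elim/quot_projW=> x; exists x.
move=> x; rewrite [quot_lin V x]/(quot_proj V x) quot_proj_eq0.
by split=> [/asboolP|] // h; apply/asboolP.
Qed.

Lemma serre_quot N L (g : {linear N -> L}) : (forall y, exists x, g x = y) ->
  S N -> S L.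
Proof.
move=> g_surj SN.
have kc : subm [set x | g x = 0].
  by split=> [|a x y /= gx gy]; rewrite /= ?linear0 // linearP gx gy scaler0 addr0.
pose K := mk_submod kc.
suff [] : S (submod K) /\ S L by [].
apply/(S_serre.2 _ N _ (val : {linear submod K -> N}) g) => //; split=> //.
  exact: val_inj.
move=> x; split=> [gx|[y <-]]; last by have := valP y; rewrite mem_mk_submod.
have Kx : x \in K by rewrite mem_mk_submod.
by exists (Sub x Kx : submod K).
Qed.

End SerreClass.

Section SerreSupport.
Variables (R : comNzRingType) (S : lmodType R -> Prop).
Hypothesis S_serre : serre_class S.
Implicit Types L M N : lmodType R.

Fact scale_linear N (z : N) : linear (fun a : R^o => (a : R) *: z).
Proof. by move=> a b c; rewrite -[a *: b]/(a * (b : R)); module. Qed.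
Definition scale_lin N (z : N) : {linear R^o -> N} := mk_linear (scale_linear z).

Lemma mem_ideal_submod (p : prime_idealr R) (a : R) :
  (a \in ideal_submod p) = (a \in p).
Proof. by []. Qed.

(** If [z] survives at [p], its annihilator lies in [p], so the submodule R z of N maps onto R/p. *)
Lemma serre_residue N (p : prime_idealr R) : S N -> supp N p -> S (residue p).
Proof.
move=> SN /suppP[z nz].
have sI : @subm R R^o [set a | a *: z = 0].
  split=> [|a b c /= bz cz]; first by rewrite /= scale0r.
  by rewrite /= [_ *: z](scale_linear z) bz cz scaler0 addr0.
pose I := mk_submod sI.
have I0 (a : R) : a \in I <-> a *: z = 0 by split=> [/asboolP|h] //; exact/asboolP.
have [|g gE] := @quot_lift R R^o I N (scale_lin z); first by move=> a /I0.
have g_inj : injective g.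
  elim/quot_projW=> a; elim/quot_projW=> b; rewrite !gE => /eqP.
  by rewrite -subr_eq0 -linearB => /eqP/I0 Iab; apply/quot_proj_inj.
have [|h hE] := @quot_lift R R^o I (residue p) (quot_lin (ideal_submod p)).
  move=> a /I0 az; apply/quot_proj_eq0; rewrite mem_ideal_submod.
  by apply/negPn/negP => na; apply: nz; exists a => //; exact/negP.
apply: (serre_quot S_serre (g := h)) (serre_sub S_serre g_inj SN).
by elim/quot_projW=> a; exists (quot_proj I a); rewrite hE.
Qed.

Lemma serre0 N : (forall x : N, x = 0) -> S N.
Proof.
move=> N0; have [[M SM] _] := S_serre.
have l0 : linear (fun _ : N => 0 : M) by move=> a x y; rewrite scaler0 addr0.
apply: (serre_sub S_serre (f := mk_linear l0)) SM.
by move=> x y _; rewrite (N0 x) (N0 y).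
Qed.

(** Noetherian induction: if a maximal submodule [V] in the class is not N, then N/V contains a copy
    of some R/p. This p is in Supp N, and the preimage of the copy is a larger submodule in the
    class, being an extension by an image of R/p. *)
Lemma serre_of_supp N : noeth_mod R^o -> noeth_mod N ->
  (forall p, supp N p -> S (residue p)) -> S N.
Proof.
move=> nR nN hS.
have [|U [sU [V [VU SV]] maxU]] := nN [set U | exists V : submodClosed N,
    (forall x, x \in V <-> U x) /\ S (submod V)].
  exists [set 0]; first exact: subm0.
  exists (mk_submod (subm0 N)); split=> [x|].
    by rewrite mem_mk_submod.
  apply: serre0 => x; apply: val_inj; rewrite linear0.
  by have := valP x; rewrite mem_mk_submod.
have [allU|/existsNP[z nz]] := EM (forall z, U z).
  have [|f fE] := @submod_lift R N N V (idfun : {linear N -> N}).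
    by move=> x; apply/VU.
  by apply: (serre_sub S_serre (f := f)) SV => x y /(congr1 val); rewrite !fE.
have [b pQ] := exists_assoc nR sU nz; set z' := b *: z in pQ.
have nz' : ~ U z' by move=> h; apply: (prime1 pQ); rewrite /transporter /= scale1r.
case: nz'; pose p := mk_prime pQ.
have pE : ideal_set p = transporter U z' by exact: prime_set_mk.
have Sp : S (residue p).
  apply: hS; apply/suppP; exists z' => -[s ns sz]; apply: ns.
  by rewrite pE /transporter /= sz; exact: sU.1.
have sU' := subm_adjoin z' sU; pose V' := mk_submod sU'.
have V'z : z' \in V' by rewrite mem_mk_submod; exact: mem_adjoin.
apply: (maxU (adjoin U z')); [by [] | | exact: sub_adjoin | exact: mem_adjoin].
exists V'; split=> [x|]; first by rewrite mem_mk_submod.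
apply/(serre_ext S_serre (submod_restr V' V)); split.
  have [|f fE] := @submod_lift R _ N V
    ((val : {linear submod V' -> N}) \o
     (val : {linear submod (submod_restr V' V) -> submod V'}))%FUN.
    by move=> x; exact: valP x.
  apply: (serre_sub S_serre (f := f)) SV => x y /(congr1 val).
  by rewrite !fE => /val_inj/val_inj.
pose w : subquot V' V := quot_proj _ (Sub z' V'z : submod V').
have wE (a : R) : scale_lin w a = quot_proj (submod_restr V' V) (a *: Sub z' V'z).
  exact: esym (quot_projZ _ _ _).
have [|g gE] := @quot_lift R R^o (ideal_submod p) (subquot V' V) (scale_lin w).
  move=> a; rewrite mem_ideal_submod => pa.
  rewrite wE; apply/quot_proj_eq0.
  rewrite unfold_in /restr_pred linearZ /=; apply/VU.
  by have : ideal_set p a by []; rewrite pE.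
apply: (serre_quot S_serre (g := g)) Sp.
elim/quot_projW=> x; have := valP x; rewrite mem_mk_submod => -[a Ux].
exists (quot_proj _ (a : R^o)); rewrite gE wE.
apply/esym/quot_proj_inj; rewrite unfold_in /restr_pred linearB linearZ /= scalerN.
exact/VU.
Qed.

End SerreSupport.

(** * Localization *)

Section LocalRing.
Variables (R : comNzRingType) (p : prime_idealr R).

Definition loc_inc (a : R) : locring p := frac (a : R^o) (denom1 p).
Definition loc_inv (s : denom p) : locring p := frac (1 : R^o) s.

Lemma loc_mulE (a b : R) (s t : denom p) :
  (frac (a : R^o) s : locring p) * (frac (b : R^o) t : locring p) =
  frac (a * b : R^o) (denomM s t).
Proof. exact: frac_scaleE. Qed.

Fact loc_inc_additive : zmod_morphism loc_inc.
Proof.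
move=> a b.
have frac_opp1 : - (frac (b : R^o) (denom1 p)) = frac (- b : R^o) (denom1 p).
  exact: frac_oppE.
rewrite /loc_inc frac_opp1 fracD !den1 !scale1r; apply/fracP; exists (denom1 p).
by rewrite denM !den1 mul1r.
Qed.

Fact loc_inc_multiplicative : monoid_morphism loc_inc.
Proof.
split=> // a b; rewrite /loc_inc loc_mulE; apply/fracP; exists (denom1 p).
by rewrite denM !den1 mul1r.
Qed.

HB.instance Definition _ := GRing.isZmodMorphism.Build R (locring p) loc_inc
  loc_inc_additive.
HB.instance Definition _ := GRing.isMonoidMorphism.Build R (locring p) loc_inc
  loc_inc_multiplicative.

Lemma loc_incV s : loc_inc (den s) * loc_inv s = 1.
Proof.
rewrite /loc_inc /loc_inv loc_mulE; apply/fracP; exists (denom1 p).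
by rewrite denM !den1 mul1r mulr1 !scale1r -[den s *: _]/(den s * 1) mulr1.
Qed.

Lemma loc_fracE (a : R) s : frac (a : R^o) s = loc_inc a * loc_inv s.
Proof.
rewrite /loc_inc /loc_inv loc_mulE; apply/fracP; exists (denom1 p).
by rewrite denM !den1 mul1r mulr1.
Qed.

Lemma mem_loc_max (x : locring p) : x \in @loc_max R p <->
  exists a s, a \in p /\ x = frac (a : R^o) s.
Proof. by split=> /asboolP. Qed.

Definition contraction (Q : prime_idealr (locring p)) : set R :=
  [set a | loc_inc a \in Q].

Lemma contraction_prime Q : is_prime (contraction Q).
Proof.
split; last by move=> a b; rewrite /contraction /= rmorphM prime_idealrM => /orP.
  split=> [|a b c Qb Qc]; rewrite /contraction /=; first by rewrite rmorph0 rpred0.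
  by rewrite rmorphD rmorphM rpredD // idealMr.
by rewrite /contraction /= rmorph1 idealr1.
Qed.

Lemma contraction_sub Q : contraction Q `<=` ideal_set p.
Proof.
move=> a; rewrite /contraction /ideal_set /= => Qa; apply/negPn/negP => na.
have : 1 \in Q.
  rewrite -(loc_incV (exist _ a na : denom p)) mulrC; exact: idealMr.
by rewrite idealr1.
Qed.

Lemma mem_frac_prime (Q : prime_idealr (locring p)) (a : R) s :
  (frac (a : R^o) s \in Q) = (loc_inc a \in Q).
Proof.
rewrite loc_fracE; apply/idP/idP => [Qa|]; last by rewrite mulrC; exact: idealMr.
have -> : loc_inc a = loc_inc (den s) * (loc_inc a * loc_inv s).
  by rewrite mulrCA loc_incV mulr1.
exact: idealMr.
Qed.

Lemma contraction_le Q Q' :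
  contraction Q `<=` contraction Q' <-> {subset Q <= Q'}.
Proof.
split=> [QQ' x|QQ' a]; last exact: QQ'.
by elim/fracW: x => a s; rewrite !mem_frac_prime; exact: QQ'.
Qed.

Definition extension (q : set R) : set (locring p) :=
  [set x | exists a s, q a /\ x = frac (a : R^o) s].

Lemma mem_extension (q : set R) (a : R) (s : denom p) : is_prime q ->
  q `<=` ideal_set p -> extension q (frac (a : R^o) s) <-> q a.
Proof.
move=> pq qp; split=> [[b [t [qb /fracP[u]]]]|qa]; last by exists a, s.
rewrite -[den t *: _]/(den t * a) -[den s *: _]/(den s * b).
rewrite -[den u *: _]/(den u * _) -[den u *: _]/(den u * (den s * b)) => e.
have nq (v : denom p) : ~ q (den v) by move=> /qp; exact/negP/denP.
have : q (den u * (den t * a)) by rewrite e; do 2!apply: primeMl => //.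
by case: (pq) => _ _ qM /qM[/nq//|/qM[/nq|]].
Qed.

Lemma extension_prime (q : set R) : is_prime q -> q `<=` ideal_set p ->
  is_prime (extension q).
Proof.
move=> pq qp; have memE := mem_extension _ _ pq qp; split.
- split; first by apply/memE; exact: prime0 pq.
  move=> x y z; elim/fracW: x => a s; elim/fracW: y => b t; elim/fracW: z => c u.
  move=> /memE qb /memE qc.
  have -> : (frac (a : R^o) s : locring p) *: (frac (b : R^o) t : (locring p)^o) =
            frac (a * b : R^o) (denomM s t) by exact: loc_mulE.
  have -> : (frac (a * b : R^o) (denomM s t) : (locring p)^o) + frac (c : R^o) u =
    frac (den u * (a * b) + den (denomM s t) * c : R^o) (denomM (denomM s t) u).
    exact: fracD.
  by apply/memE; apply: primeD => //; do !apply: primeMl => //.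
- by move=> /memE; exact: prime1 pq.
- move=> x y; elim/fracW: x => a s; elim/fracW: y => b t.
  by rewrite loc_mulE => /memE; case: (pq) => _ _ qM /qM[h|h]; [left|right]; apply/memE.
Qed.

End LocalRing.

(** * Depth and dimension of a localized module *)

Section LocalizedModule.
Variables (R : comNzRingType) (p : prime_idealr R).
Variables (M : lmodType R) (N : lmodType (locring p)) (f : M -> N).

(* [f] makes [N] a localization of [M] at [p]. *)
Definition is_locmap :=
  [/\ forall a x y, f (a *: x + y) = loc_inc p a *: f x + f y,
      forall n, exists (s : denom p) x, loc_inc p (den s) *: n = f x :> N
    & forall x, f x = 0 -> exists2 s, s \notin p & s *: x = 0].

Hypothesis lf : is_locmap.
Hypotheses (nR : noeth_mod R^o) (nM : noeth_mod M).
Notation P := (ideal_set p).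
Implicit Types (U : set M) (V : set N) (x : M) (n : N).

Let pP : is_prime P := is_prime_set p.

Lemma loc_incK (s : denom p) n : loc_inv s *: (loc_inc p (den s) *: n) = n.
Proof. by rewrite scalerA mulrC loc_incV scale1r. Qed.

Lemma locmap0 : f 0 = 0.
Proof.
have [fE _ _] := lf; have := fE (-1) 0 0; rewrite scaler0 addr0 rmorphN1 scaleN1r => ->.
by rewrite addNr.
Qed.

Lemma locmapZ a x : f (a *: x) = loc_inc p a *: f x.
Proof. by have [fE _ _] := lf; rewrite -[a *: x]addr0 fE locmap0 addr0. Qed.

Lemma locmapB x y : f (x - y) = f x - f y.
Proof.
have [fE _ _] := lf; rewrite addrC -scaleN1r fE rmorphN1 scaleN1r.
by rewrite addrC.
Qed.

(* The submodule [V] of [N] comes from the submodule [U] of [M]. *)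
Definition comes_from V U := forall x, V (f x) <-> sat P U x.

Lemma loc_unit_scale V (s : denom p) n : subm V -> V (loc_inc p (den s) *: n) -> V n.
Proof. by move=> sV Vn; rewrite -(loc_incK s n); exact: submZ. Qed.

Lemma loc_inc_scale V (s : R) n : subm V -> ~ P s -> V (loc_inc p s *: n) -> V n.
Proof. by move=> sV /negP ns; exact: (@loc_unit_scale V (exist _ s ns : denom p)). Qed.

Lemma comes_from0 : comes_from [set 0] [set 0].
Proof.
have [_ _ f0] := lf => x; split=> [/f0[s ns sx]|[s ns sx]].
  by exists s => //; exact/negP.
apply: (@loc_inc_scale [set 0] s) => //=; first exact: subm0.
by rewrite -locmapZ sx locmap0.
Qed.

Lemma comes_from_addmul V U (y : R) (s : denom p) : subm V -> subm U ->
  comes_from V U -> comes_from (addmul V (frac (y : R^o) s : locring p)) (addmul U y).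
Proof.
move=> sV sU VU x; have [_ f_div _] := lf; rewrite loc_fracE; split=> [[n Vn]|].
  have [t [m tm]] := f_div n; apply: (@sat_cancel _ _ P pP _ (den s * den t)).
    by apply: primeNM => //; exact/negP/denP.
  suff /VU [u nu Uu] : V (f ((den s * den t) *: x - y *: m)).
    exists u => //; exists (u *: m).
    suff -> : u *: ((den s * den t) *: x) - y *: (u *: m) =
              u *: ((den s * den t) *: x - y *: m) by [].
    by module.
  rewrite locmapB !locmapZ -tm.
  have -> : loc_inc p (den s * den t) *: f x - loc_inc p y *: (loc_inc p (den t) *: n) =
     (loc_inc p (den s) * loc_inc p (den t)) *: (f x - (loc_inc p y * loc_inv s) *: n).
    rewrite scalerBr !scalerA rmorphM; congr (_ - _ *: _).
    transitivity (loc_inc p y * loc_inc p (den t) * (loc_inc p (den s) * loc_inv s)).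
      by rewrite loc_incV mulr1.
    by ring.
  exact: submZ.
move=> [t nt [m Um]]; have /negP nt' := nt; pose t' : denom p := exist _ t nt'.
(* Since t x - y m is in [U], x equals (y/s)((s/t) m) modulo [V]. *)
exists ((loc_inc p (den s) * loc_inv t') *: f m).
apply: (loc_inc_scale sV nt).
have -> : loc_inc p t *: (f x - (loc_inc p y * loc_inv s) *:
    ((loc_inc p (den s) * loc_inv t') *: f m)) = f (t *: x - y *: m).
  rewrite locmapB !locmapZ scalerBr !scalerA; congr (_ - _ *: _).
  transitivity (loc_inc p y * (loc_inc p (den s) * loc_inv s) *
    (loc_inc p (den t') * loc_inv t')); last by rewrite !loc_incV !mulr1.
  by have -> : den t' = t by []; ring.
by apply/VU; exact: sub_sat.
Qed.

Lemma comes_from_reg V U (y : R) (s : denom p) : subm V -> subm U ->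
  comes_from V U ->
  (forall n, V ((frac (y : R^o) s : locring p) *: n) -> V n) <-> reg P U y.
Proof.
move=> sV sU VU; have [_ f_div _] := lf; rewrite loc_fracE.
split=> [reg_y x /VU|reg_y n Vn].
  rewrite locmapZ => Vx; apply/VU/reg_y.
  by rewrite mulrC -scalerA; exact: submZ.
have [t [x tx]] := f_div n; apply: (@loc_unit_scale V t) => //; rewrite tx.
apply/VU/reg_y/VU; rewrite locmapZ -tx scalerA.
have -> : loc_inc p y * loc_inc p (den t) =
  loc_inc p (den s) * loc_inc p (den t) * (loc_inc p y * loc_inv s).
  transitivity (loc_inc p y * loc_inc p (den t) * (loc_inc p (den s) * loc_inv s)).
    by rewrite loc_incV mulr1.
  by ring.
by rewrite -scalerA; exact: submZ.
Qed.

Lemma comes_from_full V U : subm V -> comes_from V U ->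
  (exists n, ~ V n) <-> exists x, ~ sat P U x.
Proof.
move=> sV VU; have [_ f_div _] := lf; split=> [[n nV]|[x nx]].
  have [t [x tx]] := f_div n; exists x => /VU; rewrite -tx => /(loc_unit_scale sV).
  exact: nV.
by exists (f x) => /VU.
Qed.

(** [regular_seq] for N/V, where in an induction the base submodule [V] absorbs the head of the
    sequence. *)
Definition regular_mod V (xs : seq (locring p)) :=
  (forall i, (i < size xs)%N -> forall n,
     mulseq V (take i xs) (xs`_i *: n) -> mulseq V (take i xs) n) /\
  exists n, ~ mulseq V xs n.

Lemma regular_seqE (xs : seq (locring p)) :
  regular_seq N xs <-> regular_mod [set 0] xs.
Proof.
have E (ys : seq (locring p)) n :
    quot_proj (seq_mul N ys) n = 0 <-> mulseq [set 0] ys n.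
  by rewrite quot_proj_eq0 mem_seq_mul.
split=> -[h [z nz]]; split=> [i szi|].
- move=> n; rewrite -!E quot_projZ; exact: h.
- by move: z nz; elim/quot_projW=> n nz; exists n; rewrite -E.
- by elim/quot_projW=> n; rewrite -quot_projZ !E; exact: h.
- by exists (quot_proj _ z); rewrite E.
Qed.

Lemma regular_mod_cons V (x : locring p) xs : regular_mod V (x :: xs) <->
  (forall n, V (x *: n) -> V n) /\ regular_mod (addmul V x) xs.
Proof.
split=> [[h [n nn]]|[h0 [h [n nn]]]].
  split; first exact: (h 0%N).
  by split; [move=> i; exact: (h i.+1) | exists n].
by split; [case=> [_|i] //; exact: h | exists n].
Qed.

Lemma exists_regular_mod V U r : subm V -> subm U -> comes_from V U ->
  (exists xs : seq (locring p),
     [/\ size xs = r, {subset xs <= @loc_max R p} & regular_mod V xs]) <->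
  has_reg_seq P U r.
Proof.
elim: r V U => [|r IH] V U sV sU VU.
  rewrite /= -(comes_from_full sV VU); split=> [[xs [/size0nil -> _ [_ //]]]|h].
  by exists [::].
split=> [[[|x xs] [//= [sz] xsp /regular_mod_cons[hx hxs]]]|[y [py hy]]].
  have /mem_loc_max[y [s [py xE]]] : x \in @loc_max R p by apply: xsp; exact: mem_head.
  rewrite {x}xE in hx hxs xsp; exists y; split; first exact: py.
    by apply/(comes_from_reg y s sV sU VU).
  apply/(IH _ _ (subm_addmul (frac (y : R^o) s : locring p) sV) (subm_addmul y sU)).
    exact: comes_from_addmul.
  by exists xs; split=> // z zxs; apply: xsp; rewrite in_cons zxs orbT.
pose x : locring p := frac (y : R^o) (denom1 p).
move=> /(IH _ _ (subm_addmul x sV) (subm_addmul y sU))[|xs [sz xsp hxs]].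
  exact: comes_from_addmul.
exists (x :: xs); split; first by rewrite /= sz.
  move=> z; rewrite in_cons => /orP[/eqP->|/xsp//].
  by apply/mem_loc_max; exists y, (denom1 p).
by apply/regular_mod_cons; split=> //; apply/(comes_from_reg y (denom1 p) sV sU VU).
Qed.

Lemma depth_localized : depth N (@loc_max R p) = nat_sup (has_reg_seq P [set (0 : M)]).
Proof.
rewrite /depth; congr nat_sup; rewrite predeqE => r.
rewrite -(exists_regular_mod r (subm0 N) (subm0 M) comes_from0).
by split=> -[xs [sz xsp /regular_seqE h]]; exists xs.
Qed.

Lemma supp_localized (Q : prime_idealr (locring p)) :
  supp N Q <-> ann [set (0 : M)] `<=` contraction Q.
Proof.
have [_ f_div f0] := lf; have pQ := contraction_prime Q.
rewrite suppP -(supp_ann nM pQ (subm0 M)); split=> [[n nn]|[x nx]].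
  have [t [x tx]] := f_div n; exists x => -[s ns sx]; apply: nn.
  exists (loc_inc p s * loc_inc p (den t)).
    rewrite /ideal_set /= prime_idealrM => /orP[/ns//|Qt].
    by apply: (negP (denP t)); exact: contraction_sub Qt.
  by rewrite /= -scalerA tx -locmapZ sx locmap0.
exists (f x) => -[c nc]; elim/fracW: c nc => a s; rewrite /ideal_set /= mem_frac_prime.
move=> na; rewrite loc_fracE mulrC -scalerA => h; apply: nx.
have /f0[u nu ux] : f (a *: x) = 0.
  rewrite locmapZ -[RHS](scaler0 _ (loc_inc p (den s))) -h /=.
  by rewrite [RHS]scalerA loc_incV scale1r.
exists (u * a); last by rewrite /= -scalerA.
apply: (primeNM pQ); last exact: na.
by move=> /contraction_sub; exact/negP.
Qed.

Lemma krull_dim_localized : krull_dim N = nat_sup (chain P (ann [set (0 : M)])).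
Proof.
apply: (chain_supE (F := @contraction R p)) => //.
- move=> Q /supp_localized IQ; split=> //; first exact: contraction_prime.
  exact: contraction_sub.
- exact: contraction_le.
- move=> q pq Iq qP; have pE := extension_prime pq qP.
  have QE : contraction (mk_prime pE) = q.
    rewrite predeqE => a; rewrite -(mem_extension a (denom1 p) pq qP).
    by rewrite -[X in _ <-> X]/(extension q (loc_inc p a)) -{2}(prime_set_mk pE).
  by exists (mk_prime pE) => //; apply/supp_localized; rewrite QE.
Qed.

(** Depth never exceeds dimension, and the dimension is finite by [chain_max]; so equality of the
    two suprema amounts to one r reached by the depth and not exceeded by the dimension. *)
Lemma cohen_macaulay_localized : cohen_macaulay N (@loc_max R p) <->
  (forall x, sat P [set 0] x) \/
  exists r, has_reg_seq P [set (0 : M)] r /\ ~ chain P (ann [set (0 : M)]) r.+1.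
Proof.
rewrite /cohen_macaulay depth_localized krull_dim_localized.
have full := comes_from_full (subm0 N) comes_from0.
split=> [[N0|eq_dim]|[M0|[r [hr dimr]]]].
- left=> x; apply: contrapT => nx; have [n] := full.2 (ex_intro _ x nx).
  by apply; exact: N0.
- have [/existsNP/(supp_ann nM pP (subm0 M)) MP|/contrapT M0] :=
      EM (~ forall x, sat P [set 0] x).
    right; have [r hr dimr] := chain_max nR pP MP.
    have dimE : nat_sup (chain P (ann [set (0 : M)])) = r%:E%E.
      apply: nat_sup_max => // k hk; rewrite leqNgt; apply/negP => rk.
      by apply: dimr; exact: chain_leq rk hk.
    by rewrite dimE in eq_dim; have [hr' _] := nat_sup_fin eq_dim; exists r.
  by left.
- left=> n; apply: contrapT => nn; have [x] := full.1 (ex_intro _ n nn).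
  by apply.
- right; have chain_r k : chain P (ann [set (0 : M)]) k -> (k <= r)%N.
    move=> hk; rewrite leqNgt; apply/negP => rk; apply: dimr; exact: chain_leq rk hk.
  rewrite (nat_sup_max (n := r)) // => [|k hk].
    rewrite (nat_sup_max (n := r)) //.
    exact: (has_reg_seq_chain nR nM pP (subm0 M) hr).
  by apply: chain_r; exact: (has_reg_seq_chain nR nM pP (subm0 M) hk).
Qed.

End LocalizedModule.

Section LocalizationMaps.
Variables (R : comNzRingType) (p : prime_idealr R).

Lemma frac_locmap (M : lmodType R) :
  is_locmap (fun x : M => frac x (denom1 p) : locmod p M).
Proof.
split=> [a x y||x /frac_eq0//].
  have -> : loc_inc p a *: (frac x (denom1 p) : locmod p M) =
    frac (a *: x) (denomM (denom1 p) (denom1 p)) by exact: frac_scaleE.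
  rewrite fracD; apply/fracP; exists (denom1 p).
  by rewrite !denM !den1 !mul1r !scale1r.
elim/fracW=> x s; exists s, x.
have -> : loc_inc p (den s) *: (frac x s : locmod p M) =
  frac (den s *: x) (denomM (denom1 p) s) by exact: frac_scaleE.
by apply/fracP; exists (denom1 p); rewrite !denM !den1 !mul1r !scale1r.
Qed.

(** The instance for [cohen_macaulay_ring], where the local ring is a module over itself. *)
Lemma loc_inc_locmap : is_locmap (fun a : R^o => loc_inc p a : (locring p)^o).
Proof.
split=> [a x y||x /frac_eq0//]; first by rewrite rmorphD rmorphM.
elim/fracW=> a s; exists s, a.
by rewrite loc_fracE -[_ *: _]/(_ * _) mulrCA loc_incV mulr1.
Qed.

End LocalizationMaps.

(** * Quotients of local Cohen-Macaulay rings *)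

Section Surjection.
Variables (A R : comNzRingType) (f : {rmorphism A -> R}).
Hypothesis f_surj : forall y, exists x, f x = y.
Implicit Types (p q I : set R).

Lemma preimage_prime q : is_prime q -> is_prime (f @^-1` q).
Proof.
move=> pq; split; last by move=> a b /=; rewrite rmorphM; case: pq => _ _; apply.
  split=> [|a b c qb qc] /=; first by rewrite rmorph0; exact: prime0 pq.
  by rewrite rmorphD rmorphM; apply: primeD => //; exact: primeMl.
by rewrite /= rmorph1; exact: prime1 pq.
Qed.

Lemma mem_image_ker (J : set A) a : @subm A A^o J -> (forall b, f b = 0 -> J b) ->
  (f @` J) (f a) <-> J a.
Proof.
move=> sJ kJ; split=> [[b Jb fab]|]; last by exists a.
rewrite -[a](subrK b); apply: (submD sJ) => //; apply: kJ.
by rewrite rmorphB fab subrr.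
Qed.

Lemma image_prime (q : set A) : is_prime q -> (forall a, f a = 0 -> q a) ->
  is_prime (f @` q).
Proof.
move=> pq kq; have imE a := mem_image_ker a (prime_subm pq) kq; split.
- split; first by rewrite -(rmorph0 f); apply/imE; exact: prime0 pq.
  move=> x y z; have [a <-] := f_surj x; have [b <-] := f_surj y.
  have [c <-] := f_surj z => /imE qb /imE qc.
  rewrite -[f a *: _]/(f a * f b) -rmorphM -[_ + _]/(f (a * b) + f c) -rmorphD.
  by apply/imE; apply: primeD => //; exact: primeMl.
- by rewrite -(rmorph1 f) => /imE; exact: prime1 pq.
- move=> x y; have [a <-] := f_surj x; have [b <-] := f_surj y.
  rewrite -rmorphM => /imE; case: (pq) => _ _ qM /qM[h|h]; [left|right]; exact/imE.
Qed.

Lemma chain_preimage p I n : chain p I n -> chain (f @^-1` p) (f @^-1` I) n.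
Proof.
elim=> {I n} [I Ip|I q J c n pq Iq qJ Jc nc _ IH].
  by apply: chain0 => a /Ip.
have [b bc] := f_surj c.
apply: (chainS (preimage_prime pq) _ _ _ _ IH (c := b)) => /=.
- by move=> a /Iq.
- by move=> a /qJ.
- by rewrite bc.
- by rewrite bc.
Qed.

Lemma chain_image p (J : set A) n : (forall a, f a = 0 -> J a) ->
  chain (f @^-1` p) J n -> chain p (f @` J) n.
Proof.
move=> kJ h; elim: h kJ => {J n} [J Jp|J q K c n pq Jq qK Kc nc _ IH] kJ.
  by apply: chain0 => _ [a /Jp pa <-].
have kq a : f a = 0 -> q a by move=> /kJ/Jq.
apply: (chainS (image_prime pq kq) _ _ _ _ (IH _) (c := f c)).
- exact: image_subset.
- exact: image_subset.
- by exists c.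
- by move=> /(mem_image_ker c (prime_subm pq) kq).
- by move=> a /kq/qK.
Qed.

Lemma chain_preimageE p q n : is_prime q ->
  chain (f @^-1` p) (f @^-1` q) n <-> chain p q n.
Proof.
move=> pq; split=> [h|]; last exact: chain_preimage.
have -> : q = f @` (f @^-1` q).
  rewrite predeqE => x; split=> [qx|[a qa <-]//].
  by have [a fa] := f_surj x; exists a => //=; rewrite fa.
by apply: chain_image h => a /= ->; exact: prime0 pq.
Qed.

End Surjection.

(** * Dimension, length and parameters over a local ring *)

Section LocalNoetherian.
Variables (R : comNzRingType) (m : idealr R).
Hypotheses (R_noeth : noetherian R) (R_local : is_local m).
Notation mm := (ideal_set m).

Lemma noeth_regular (A : comNzRingType) : noetherian A -> noeth_mod A^o.
Proof.
move=> nA; apply: noeth_fin_gen => //; exists [:: 1] => x.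
exists (fun=> x); rewrite big_ord1 /=; exact: esym (mulr1 _).
Qed.

Let nR : noeth_mod R^o := noeth_regular R_noeth.

Lemma exists_maximal_ideal (I : set R) : @subm R R^o I -> ~ I 1 ->
  exists2 J : idealr R, maximal_ideal J & I `<=` ideal_set J.
Proof.
move=> sI nI.
have [|J [sJ [nJ IJ] maxJ]] := nR (F := [set J : set R^o | ~ J 1 /\ I `<=` J]).
  by exists I => //; split=> // a.
exists (mk_idealr sJ nJ); last by rewrite ideal_set_mk.
move=> K JK; have JK' : J `<=` ideal_set K by move=> a Ja; apply: JK; exact/asboolP.
move=> a Ka; apply/asboolP; apply: (maxJ (ideal_set K)) => //.
  exact: subm_ideal_set.
split; first by rewrite /ideal_set /= idealr1.
exact: subset_trans IJ JK'.
Qed.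

Lemma local_unit x : ~ mm x -> exists y, y * x = 1.
Proof.
move=> nx; apply: contrapT => nu; apply: nx.
have sI : @subm R R^o (@adjoin R R^o [set 0] x) by apply: subm_adjoin; exact: subm0.
have [|J maxJ IJ] := exists_maximal_ideal sI.
  by move=> [y /eqP]; rewrite subr_eq0 => /eqP e; apply: nu; exists y.
rewrite /ideal_set /= -(R_local.2 J maxJ); apply: IJ.
by apply: mem_adjoin; exact: subm0.
Qed.

Lemma prime_sub_max q : is_prime q -> q `<=` mm.
Proof.
move=> pq x qx; apply: contrapT => /local_unit[y yx].
by apply: (prime1 pq); rewrite -yx; exact: primeMl.
Qed.

Lemma max_prime : is_prime mm.
Proof.
split; [exact: subm_ideal_set | by rewrite /ideal_set /= idealr1 |].
move=> a b mab; have [ma|/local_unit[y ya]] := EM (mm a); [by left | right].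
have -> : b = y * (a * b) by rewrite mulrA ya mul1r.
exact: (submZ (@subm_ideal_set _ m)).
Qed.

Lemma saturated_at_max (M : lmodType R) (U : set M) : subm U -> sat mm U `<=` U.
Proof.
move=> sU z [s /local_unit[y ys] Us].
by rewrite -[z]scale1r -ys -scalerA; exact: submZ.
Qed.

Section Module.
Variable M : lmodType R.
Hypothesis nM : noeth_mod M.

Lemma supp_annE (p : prime_idealr R) :
  supp M p <-> ann [set (0 : M)] `<=` ideal_set p.
Proof. by rewrite suppP (supp_ann nM (is_prime_set p) (subm0 M)). Qed.

Lemma krull_dimE : krull_dim M = nat_sup (chain mm (ann [set (0 : M)])).
Proof.
apply: (chain_supE (F := @ideal_set R)) => //; first exact: max_prime.
- move=> P /supp_annE MP; split=> //; first exact: is_prime_set.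
  exact/prime_sub_max/is_prime_set.
- by move=> q pq Iq _; exists (mk_prime pq); rewrite ?supp_annE prime_set_mk.
Qed.

(** For a prime q other than m in the support, take z nonzero at q and c in m outside q: the
    submodules U + R c^i z descend strictly, since a repetition would let c^j (1 - r c), which is
    outside q, kill z. Conversely, every submodule is saturated at m and [finite_length] applies. *)
Lemma mod_length_fin (U : submodClosed M) :
  mod_length (quotmod U) <> +oo%E <-> ~ chain mm (ann [set x | x \in U]) 1.
Proof.
set V := [set x | x \in U]; have sV : subm V by exact: subm_submod.
rewrite /mod_length /chain_sup nat_sup_neq_pinfty; last first.
  by exists (fun=> mk_submod (subm0 _)).
split=> [[n bound]|dimV].
  move=> /chain_gap[q [c [pq Vq qm mc nqc]]].
  have [z nz] := (supp_ann nM pq sV).2 Vq.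
  pose W i := adjoin V (c ^+ i *: z).
  have sW i : subm (W i) by exact: subm_adjoin.
  pose t i : submodClosed (quotmod U) := mk_submod (subm_image (quot_lin U) (sW i)).
  have memt i x : quot_proj U x \in t i <-> W i x.
    rewrite mem_mk_submod; split=> [[y Wy /quot_proj_inj Uyx]|Wx]; last by exists x.
    rewrite -[x](subKr y); apply: submB => //; exact: sub_adjoin.
  suff /bound : exists t : nat -> submodClosed (quotmod U),
      (forall i, (i <= n.+1)%N -> True) /\
      (forall i, (i < n.+1)%N -> submod_lt (t i) (t i.+1)) by rewrite ltnn.
  (* The powers of c give a descending sequence, read backwards as a chain of length [n.+1]. *)
  exists (fun i => t (n.+1 - i)%N); split=> // i lin.
  rewrite -[(n.+1 - i)%N]subSS subSn //.
  set j := (n.+1 - i.+1)%N; split.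
    elim/quot_projW=> x /memt Wx; apply/memt; apply: adjoin_min Wx => //.
      exact: sub_adjoin.
    by rewrite exprS -scalerA; apply: submZ => //; exact: mem_adjoin.
  move=> h; have /memt[r Vr] : quot_proj U (c ^+ j *: z) \in t j.+1.
    by apply/h/memt; exact: mem_adjoin.
  apply: nz; exists (c ^+ j * (1 - r * c)); last first.
    by move: Vr; congr (V _); rewrite exprS; module.
  apply: (primeNM pq).
    by elim: (j) => [|k IH]; [exact: prime1 pq | rewrite exprS; exact: primeNM].
  move=> /qm h1; apply: (prime1 max_prime); rewrite -[1](subrK (r * c)).
  by apply: (primeD max_prime) => //; exact: (primeMl max_prime).
have pm := max_prime.
have [|n bound] := finite_length nR nM pm sV.
  move=> q pq Vq qm; apply: contrapT => /nonsubset[c [mc nqc]]; apply: dimV.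
  exact: (chainS pq Vq qm mc nqc (chain0 (@subset_refl _ mm))).
exists n => k [t [_ tlt]]; rewrite leqNgt; apply/negP => nk.
(* The chain [t] is controlled only up to index [k] and is frozen there. *)
pose W i : set M := [set x | quot_proj U x \in t (minn i k)].
have [i|i x|i lein Wi] := bound W.
- have sW : subm (W i).
    split=> [|a x y Wx Wy]; rewrite /W /=.
      by rewrite (quot_proj_eq0 U 0).2 ?rpred0.
    by rewrite quot_proj_linear; apply: rpredD => //; exact: rpredZ.
  split=> //; first exact: saturated_at_max.
  by move=> x /quot_proj_eq0 Ux; rewrite /W /= Ux rpred0.
- rewrite /W /=; case: (ltnP i k) => ik; last by rewrite (minn_idPr (leqW ik)).
  by rewrite (minn_idPl ik) => /(tlt i ik).1.
have ik : (i < k)%N by exact: leq_ltn_trans nk.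
apply: (tlt i ik).2; elim/quot_projW=> x tx; move: (Wi x).
by rewrite /W /= (minn_idPl ik) (minn_idPl (ltnW ik)); apply.
Qed.

Lemma sys_paramE (xs : seq R) : sys_param M m xs <->
  [/\ {in xs, forall x, mm x}, chain mm (ann [set (0 : M)]) (size xs),
      ~ chain mm (ann [set (0 : M)]) (size xs).+1 &
      ~ chain mm (ann (mulseq [set (0 : M)] xs)) 1].
Proof.
have seqE : [set x | x \in seq_mul M xs] = mulseq [set 0] xs.
  by rewrite predeqE => x; rewrite /= mem_seq_mul.
have finE := mod_length_fin (seq_mul M xs); rewrite seqE in finE.
rewrite /sys_param krull_dimE.
split=> [[xsm dimE /finE h3]|[xsm h1 h2 /finE h3]]; split=> //.
- by have [] := nat_sup_fin dimE.
- by have [] := nat_sup_fin dimE.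
apply: nat_sup_max => // k hk; rewrite leqNgt; apply/negP => lt.
by apply: h2; exact: chain_leq lt hk.
Qed.

End Module.

Lemma krull_dim_residue (p : prime_idealr R) :
  krull_dim (residue p) = nat_sup (chain mm (ideal_set p)).
Proof.
apply: (chain_supE (F := @ideal_set R)) => //; first exact: max_prime.
- move=> P /supp_cyclic pP; split=> //; first exact: is_prime_set.
  exact/prime_sub_max/is_prime_set.
- move=> q pq pq' _; exists (mk_prime pq); last by rewrite prime_set_mk.
  by apply/supp_cyclic => a pa; apply/asboolP; exact: pq'.
Qed.

(* The relevant localization of the Cohen-Macaulay ring [A] is that at the
   preimage of the maximal ideal. *)
Lemma quotient_catenary (A : comNzRingType) (f : {rmorphism A -> R})
    (p q : set R) k e :
    cohen_macaulay_ring A -> (forall y, exists x, f x = y) ->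
    is_prime p -> is_prime q -> q `<=` p ->
  chain mm q (k + e) -> ~ chain mm p e.+1 -> chain p q k.
Proof.
move=> [A_noeth A_CM] f_surj pp pq qp hq dimp.
have pm := max_prime; have pn := preimage_prime f pm.
pose n := mk_prime pn; have nE : ideal_set n = f @^-1` mm by exact: prime_set_mk.
have n_max : maximal_ideal n.
  move=> J nJ x Jx; apply: contrapT => nx.
  have /local_unit[y yfx] : ~ mm (f x) by move=> h; apply: nx; apply/asboolP.
  have [z fz] := f_surj y; suff : 1 \in J by rewrite idealr1.
  rewrite -[1](subrK (z * x)); apply: rpredD; last exact: idealMr.
  apply/nJ/asboolP; rewrite /= rmorphB rmorphM rmorph1 fz yfx subrr.
  exact: prime0.
have nA := noeth_regular A_noeth.
have [A0|[r [hr dimr]]] :=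
    (cohen_macaulay_localized (loc_inc_locmap n) nA nA).1 (A_CM n n_max).
  (* The local ring is nonzero: a denominator killing 1 would be 0 and lie in [n]. *)
  have [s ns /= s1] := A0 1; case: ns; rewrite nE /= -[s]mulr1.
  by rewrite -[s * 1]/(s *: (1 : A^o)) s1 rmorph0; exact: prime0.
apply/(chain_preimageE f_surj p k pq).
rewrite nE in hr dimr.
apply: (cohen_macaulay_catenary nA nA pn (preimage_prime f pp) (preimage_prime f pq)
  (subm0 A^o) hr dimr) (chain_preimage f_surj hq) _.
- move=> a /(_ 1) /=; rewrite -[a *: _]/(a * 1) mulr1 => ->.
  by rewrite rmorph0; exact: prime0.
- by move=> a /qp.
- by move=> a; exact: prime_sub_max.
- by move=> /(chain_preimageE f_surj _ _ pp).
Qed.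

End LocalNoetherian.

(** * S-Cohen-Macaulay modules *)

Section SerreCohenMacaulay.
Variables (R : comNzRingType) (m : idealr R) (S : lmodType R -> Prop).
Variable M : lmodType R.
Hypotheses (R_noeth : noetherian R) (R_local : is_local m) (M_fg : fin_gen M).
Hypothesis S_serre : serre_class S.
Notation mm := (ideal_set m).
Notation I := (ann [set (0 : M)]).

Let nR : noeth_mod R^o := noeth_regular R_noeth.
Let nM : noeth_mod M := noeth_fin_gen R_noeth M_fg.
Let pm : is_prime mm := max_prime R_noeth R_local.
Let sM : subm [set (0 : M)] := subm0 M.

Lemma cohen_macaulay_atE (p : prime_idealr R) : cohen_macaulay_at M p <->
  ~ I `<=` ideal_set p \/
  exists r, has_reg_seq (ideal_set p) [set (0 : M)] r /\ ~ chain (ideal_set p) I r.+1.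
Proof.
have pp := is_prime_set p.
rewrite /cohen_macaulay_at (cohen_macaulay_localized (frac_locmap p M) nR nM).
split=> [[h|]|[h|]]; [left | by right | left | by right].
  by move=> /(supp_ann nM pp sM)[z]; exact.
move=> x; apply: contrapT => nx; apply: h.
by apply/(supp_ann nM pp sM); exists x.
Qed.

Lemma serre_generization (p q : prime_idealr R) :
  {subset q <= p} -> S (residue q) -> S (residue p).
Proof. by move=> qp Sq; apply: (serre_residue S_serre Sq); apply/supp_cyclic. Qed.

Lemma weak_seqE (xs : seq R) : weak_seq S M xs <->
  forall p : prime_idealr R, ~ S (residue p) -> forall i, (i < size xs)%N ->
    reg (ideal_set p) (mulseq [set (0 : M)] (take i xs)) xs`_i.
Proof.
have seqE (ys : seq R) : [set x | x \in seq_mul M ys] = mulseq [set 0] ys.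
  by rewrite predeqE => x; rewrite /= mem_seq_mul.
split=> [wk p nSp i szi z hz|h i szi].
  apply: contrapT => nz; apply: nSp.
  apply: (serre_residue S_serre (wk i szi)); apply/supp_subquot.
  have [s ns sz] := hz; exists (s *: z).
    have : xs`_i *: (s *: z) \in seq_mul M (take i xs) by
      rewrite mem_seq_mul scalerA mulrC -scalerA.
    exact.
  by rewrite seqE => /(sat_cancel (is_prime_set p) ns).
apply: (serre_of_supp S_serre nR); first exact/noeth_quot/noeth_submod.
move=> p /supp_subquot[z zcolon]; rewrite seqE => nz.
have : xs`_i *: z \in seq_mul M (take i xs) by exact: zcolon.
rewrite mem_seq_mul => xz; apply: contrapT => nSp; apply: nz.
by apply: (h p nSp i szi); apply: sub_sat => //; exact: is_prime_set.
Qed.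

(* A system of parameters of [M] starts with [dim M - dim R/p] elements of [p]. *)
Lemma serre_cohen_macaulay_localize (p : prime_idealr R) :
    serre_cohen_macaulay S M m -> ~ S (residue p) -> I `<=` ideal_set p ->
  exists d e, [/\ chain mm I d /\ ~ chain mm I d.+1,
    chain mm (ideal_set p) e /\ ~ chain mm (ideal_set p) e.+1, (e <= d)%N,
    has_reg_seq (ideal_set p) [set (0 : M)] (d - e) &
    ~ chain (ideal_set p) I (d - e).+1].
Proof.
move=> SCM nSp Ip; have pp := is_prime_set p.
have p_m := prime_sub_max R_noeth R_local pp.
have [e he dimp] := chain_max nR pm p_m.
have [d hd dimM] := chain_max nR pm (subset_trans Ip p_m).
have ed : (e <= d)%N.
  rewrite leqNgt; apply/negP => lt; apply: dimM.
  exact: chain_leq lt (chain_sub Ip he).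
have [|xs [szx xsp dimx]] := exists_seq (k := d - e) nR pm pp sM dimp.
  by rewrite subnK.
(* With [m] for [p] and target dimension 0, the same lemma completes [xs] by e elements to a system
   of parameters. *)
have [|ys [szy ysm dimy]] := @exists_seq _ _ nR mm mm (mulseq [set (0 : M)] xs) e 0%N
    pm pm (subm_mulseq xs sM) (@chain_irrefl _ _ 0 pm).
  by rewrite addn0.
have /SCM/weak_seqE hreg : sys_param M m (xs ++ ys).
  apply/(sys_paramE R_noeth R_local nM); rewrite size_cat szx szy subnK // mulseq_cat.
  split=> // x; rewrite mem_cat => /orP[/xsp/p_m|/ysm]//.
exists d, e; split=> //.
  rewrite -szx; apply: reg_has_reg_seq => // i szi.
  have := hreg p nSp i; rewrite size_cat nth_cat szi takel_cat; last exact: ltnW.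
  by apply; exact: ltn_addr.
move=> h; apply: dimM; have := chain_cat h he.
by rewrite addSn subnK.
Qed.

Variable a : submodClosed R^o.
Hypothesis a_locus : forall p : prime_idealr R,
  ~ cohen_macaulay_at M p <-> {subset a <= p}.

Lemma serre_locusE : S (quotmod a) <->
  forall p : prime_idealr R, ~ S (residue p) -> cohen_macaulay_at M p.
Proof.
split=> [Sa p nSp|h].
  apply: contrapT => /a_locus ap; apply: nSp.
  by apply: (serre_residue S_serre Sa); apply/supp_cyclic.
apply: (serre_of_supp S_serre nR (noeth_quot nR)) => p /supp_cyclic/a_locus nCM.
by apply: contrapT => /h.
Qed.

End SerreCohenMacaulay.

(** * Equidimensionality of the S-support *)

Theorem theorem3p13 (R : comNzRingType) (m : idealr R)
    (R_noeth : noetherian R) (R_local : is_local m)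
    (R_quot : exists (A : comNzRingType) (f : {rmorphism A -> R}),
        cohen_macaulay_ring A /\ forall y : R, exists x : A, f x = y)
    (S : lmodType R -> Prop) (S_serre : serre_class S)
    (M : lmodType R) (M_fg : fin_gen M)
    (a : submodClosed R^o)
    (a_locus : forall p : prime_idealr R,
        ~ cohen_macaulay_at M p <-> {subset a <= p}) :
  serre_cohen_macaulay S M m <->
  (S (quotmod a) /\
   forall p : prime_idealr R, minimal_in (serre_supp S M) p ->
     krull_dim (residue p) = krull_dim M).
Proof.
have nR := noeth_regular R_noeth; have nM := noeth_fin_gen R_noeth M_fg.
have pm := max_prime R_noeth R_local; have sM := subm0 M.
have suppE p := supp_annE nM p.
have dimE := krull_dimE R_noeth R_local nM.
have dim_resE := krull_dim_residue R_noeth R_local.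
have catenary p q k e : is_prime p -> is_prime q -> q `<=` p ->
    chain (ideal_set m) q (k + e) -> ~ chain (ideal_set m) p e.+1 -> chain p q k.
  have [A [f [A_CM f_surj]]] := R_quot.
  exact: (quotient_catenary R_noeth R_local A_CM f_surj).
rewrite (serre_locusE R_noeth S_serre a_locus).
split=> [SCM|[CM equidim]].
  have loc p := serre_cohen_macaulay_localize R_noeth R_local M_fg S_serre (p := p) SCM.
  split=> [p nSp|p [[/suppE Mp nSp] minp]].
    apply/(cohen_macaulay_atE R_noeth M_fg).
    have [Mp|] := EM (ann [set (0 : M)] `<=` ideal_set p); last by left.
    by right; have [d [e [_ _ _ hr dimr]]] := loc p nSp Mp; exists (d - e)%N.
  have [d [e [[hd dimM] [he dimp] ed hr _]]] := loc p nSp Mp.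
  have eq_ed : e = d.
    (* If d - e were positive, depth d - e at [p] would give a prime of Supp M strictly below [p],
       which is in the S-support by generization. *)
    apply/eqP; rewrite eqn_leq ed leqNgt; apply/negP => lt.
    have := has_reg_seq_chain nR nM (is_prime_set p) sM hr.
    rewrite -subn_gt0 in lt; rewrite -(prednK lt).
    move=> /chain_gap[q [c [pq Mq qp pc nqc]]].
    have /sub_mk_prime pq' : {subset p <= mk_prime pq}; last by apply/nqc/pq'.
    apply: minp; last exact/mk_prime_sub.
    split; first by apply/suppE; rewrite prime_set_mk.
    by apply: contra_not nSp; apply: (serre_generization S_serre); exact/mk_prime_sub.
  rewrite dim_resE dimE; rewrite eq_ed in he dimp.
  rewrite !(nat_sup_max (n := d)) // => k hk; rewrite leqNgt; apply/negP => lt.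
    by apply: dimM; exact: chain_leq lt hk.
  by apply: dimp; exact: chain_leq lt hk.
move=> xs /(sys_paramE R_noeth R_local nM)[xsm hd dimM dimxs].
apply/(weak_seqE R_noeth M_fg S_serre) => p nSp i szi.
have pp := is_prime_set p; have p_m := prime_sub_max R_noeth R_local pp.
set P := ideal_set p in pp p_m *; set Z := [set (0 : M)] in hd dimM dimxs *.
(* Three cases are immediate: the current parameter is a unit at [p], an earlier one is and the
   quotient vanishes at [p], or M itself vanishes at [p]. *)
have [Px|nPx] := EM (P xs`_i); last by move=> z; exact: sat_cancel.
have [Pxs|nPxs] := EM ({in take i xs, forall x, P x}); last first.
  move=> z _; apply: contrapT => nz; apply: nPxs => x xin; apply: contrapT => nx.
  by apply: nz; exists x => //; exact: mem_mulseq.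
have [MP|nMP] := EM (ann Z `<=` P); last first.
  move=> z _; apply: sat_sub (@sub_mulseq _ _ Z _) _ _; apply: contrapT => nz.
  by apply/nMP/(supp_ann nM pp sM); exists z.
have [//|[r [hr dimr]]] := (cohen_macaulay_atE R_noeth M_fg p).1 (CM p nSp).
have [e he dimp] := chain_max nR pm p_m.
(* The head [q] of a longest chain up to [p] is a minimal prime of M, hence minimal in the
   S-support. *)
have [n /(chain_head pp)[q [pq Mq qP hn]] dimn] := chain_max nR pp MP.
have /equidim : minimal_in (serre_supp S M) (mk_prime pq).
  split.
    split; first by apply/suppE; rewrite prime_set_mk.
    by apply: contra_not nSp; apply: (serre_generization S_serre); exact/mk_prime_sub.
  move=> Q [/suppE MQ _] /sub_mk_prime Qq; apply/mk_prime_sub => c qc.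
  apply: contrapT => nQc; apply: dimn.
  exact: (chainS (is_prime_set Q) MQ Qq qc nQc hn).
rewrite dim_resE dimE (@nat_sup_max (chain _ (ann Z)) _ hd) => [|k hk]; last first.
  by rewrite leqNgt; apply/negP => lt; apply: dimM; exact: chain_leq lt hk.
rewrite prime_set_mk => dim_q; have [hq _] := nat_sup_fin dim_q.
have ed : (e <= size xs)%N.
  rewrite leqNgt; apply/negP => lt; apply: dimM.
  exact: chain_leq lt (chain_sub MP he).
(* Equidimensionality enters here: as dim R/q = dim M, the dimension formula gives a chain from [q]
   to [p] of length dim M - dim R/p. *)
have le_r : (size xs - e <= r)%N.
  rewrite leqNgt; apply/negP => lt; apply: dimr; apply: chain_leq lt _.
  by apply: chain_sub Mq _; apply: (catenary P q _ e) => //; rewrite subnK.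
pose ys := take i.+1 xs; have szy : size ys = i.+1 by rewrite size_takel.
have ysE : ys = rcons (take i xs) xs`_i by exact: take_nth.
have ysP : {in ys, forall x, P x}.
  by move=> x; rewrite ysE mem_rcons in_cons => /orP[/eqP->//|]; exact: Pxs.
(* The remaining parameters lower the dimension by at most one each and end at 0, which bounds the
   dimension left by the first [i.+1]. *)
have dimy : ~ chain (ideal_set m) (ann (mulseq Z ys)) (size xs - i.+1).+1.
  move=> h; apply: dimxs; rewrite -(cat_take_drop i.+1 xs) mulseq_cat.
  apply: (chain_mulseq nR nM pm (subm_mulseq _ sM)).
    by move=> x /mem_drop/xsm.
  by rewrite size_drop addn1.
have yP : ann (mulseq Z ys) `<=` P by exact: ann_mulseq_sub.
have le_e : (e <= size xs - i.+1)%N.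
  rewrite leqNgt; apply/negP => lt; apply: dimy.
  exact: chain_leq lt (chain_sub yP he).
have := cohen_macaulay_reg nR nM pp sM hr dimr ysP.
rewrite szy => /(_ _ _ i); rewrite take_takel // nth_take //; apply => //.
  by apply: leq_trans le_r; move: le_e ed szi; clear; lia.
(* Continued from [p] to m by e steps, such a chain would be longer than [size xs - i.+1], because
   [size xs - e <= r]. *)
move=> h; apply: dimy; apply: chain_leq (chain_cat h he).
by move: le_e ed szi le_r; clear; lia.
Qed.
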